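(* Let $\pi$ be an irreducible permutation on a finite alphabet $\mathcal{A}$, and let $2g=\dim H(\pi)$. Then the action of the Rauzy monoid $\Pi(\pi)$ on $H(\pi)$ is strongly pinching: for every $C>0$ there is $\gamma\in\Pi(\pi)$ such that, writing $x=\Theta(\gamma)|_{H(\pi)}$, $\ln\sigma_g(x)>C$ and $\ln\sigma_i(x)>C\ln\sigma_{i+1}(x)$ for all $1\le i\le g-1$.
   Context: $\sigma_1(x)\ge\dots\ge\sigma_{2g}(x)$ denote the singular values of $x$ with respect to an inner product on $H(\pi)$ (the property does not depend on the choice). A permutation is a pair $\pi=(\pi_0,\pi_1)$ of bijections $\mathcal{A}\to\{1,\dots,d\}$, $d\ge2$; irreducible means no $1\le k<d$ with $\pi_0^{-1}(\{1,\dots,k\})=\pi_1^{-1}(\{1,\dots,k\})$. $\Omega(\pi)$ on $\mathbb{R}^{\mathcal{A}}$: $\langle\Omega(\pi)e_x,e_y\rangle=1$ if $\pi_0(x)>\pi_0(y),\pi_1(x)<\pi_1(y)$; $-1$ if $\pi_0(x)<\pi_0(y),\pi_1(x)>\pi_1(y)$; $0$ otherwise; $H(\pi)=\Omega(\pi)\mathbb{R}^{\mathcal{A}}$. Rauzy operations: with $x,y$ the last letters of top and bottom rows, the top operation moves $y$ in the bottom row to just right of $x$ (winner $x$, loser $y$), the bottom operation moves $x$ in the top row to just right of $y$ (winner $y$, loser $x$). $\Pi(\pi)$ is the monoid of paths in the Rauzy diagram starting and ending at $\pi$. For an arrow with winner $w$, loser $\ell$: $\Theta(\gamma)e_w=e_w+e_\ell$,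 $\Theta(\gamma)e_z=e_z$ otherwise; $\Theta(\gamma_1\gamma_2)=\Theta(\gamma_2)\Theta(\gamma_1)$; $\Theta(\gamma)$ preserves $H(\pi)$ for $\gamma\in\Pi(\pi)$. *)

(* Defs.v *)
From HB Require Import structures.
From mathcomp Require Import all_boot all_order all_algebra.
From mathcomp Require Import reals exp.
Set Implicit Arguments. Unset Strict Implicit. Unset Printing Implicit Defensive.
Import Order.TTheory GRing.Theory Num.Theory.
Local Open Scope ring_scope.

Section Rauzy.
Variable A : finType.

(* A permutation pi = (pi_0, pi_1); positions are 0-based: pi_e : A -> {0,..,d-1},
   d = #|A|.  (pi.1 = top row pi_0, pi.2 = bottom row pi_1.) *)
Definition perm_pair := ({ffun A -> nat} * {ffun A -> nat})%type.

Definition valid_perm (p : perm_pair) : Prop :=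
  [/\ (2 <= #|A|)%N,
      forall a, (p.1 a < #|A|)%N, forall a, (p.2 a < #|A|)%N,
      injective p.1 & injective p.2].

Definition irreducible (p : perm_pair) : Prop :=
  valid_perm p /\
  forall k : nat, (0 < k)%N -> (k < #|A|)%N ->
    [set a | (p.1 a < k)%N] != [set a | (p.2 a < k)%N].

Definition last_top (p : perm_pair) : option A := [pick a | p.1 a == #|A|.-1].
Definition last_bot (p : perm_pair) : option A := [pick a | p.2 a == #|A|.-1].

(* One Rauzy operation: [top = true] is the top operation, [false] the bottom one.
   Returns the new permutation together with (winner, loser). *)
Definition rauzy_step (top : bool) (p : perm_pair) : option (perm_pair * (A * A)) :=
  match last_top p, last_bot p with
  | Some x, Some y =>
    if top then
      Some ((p.1, [ffun z => if z == y then (p.2 x).+1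
                             else if (p.2 x < p.2 z)%N then (p.2 z).+1 else p.2 z]),
            (x, y))
    else
      Some (([ffun z => if z == x then (p.1 y).+1
                        else if (p.1 y < p.1 z)%N then (p.1 z).+1 else p.1 z], p.2),
            (y, x))
  | _, _ => None
  end.

Variable R : realType.
Local Notation d := #|A|.

(* Theta of an arrow with winner w, loser l (column-vector convention):
   Theta e_w = e_w + e_l, Theta e_z = e_z otherwise. *)
Definition theta_arrow (w l : A) : 'M[R]_d :=
  1%:M + delta_mx (enum_rank l) (enum_rank w).

(* Follow a path (sequence of arrow types) from p; returns the endpoint and
   Theta(path), with Theta(g1 g2) = Theta(g2) Theta(g1). *)
Fixpoint run_path (p : perm_pair) (s : seq bool) (T : 'M[R]_d)
  : option (perm_pair * 'M[R]_d) :=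
  match s with
  | [::] => Some (p, T)
  | b :: s' =>
    match rauzy_step b p with
    | Some (p', (w, l)) => run_path p' s' (theta_arrow w l *m T)
    | None => None
    end
  end.

Definition in_rauzy_monoid (p : perm_pair) (s : seq bool) (T : 'M[R]_d) : Prop :=
  run_path p s 1%:M = Some (p, T).

Definition omega_val (p : perm_pair) (x y : A) : R :=
  if (p.1 y < p.1 x)%N && (p.2 x < p.2 y)%N then 1
  else if (p.1 x < p.1 y)%N && (p.2 y < p.2 x)%N then -1 else 0.

(* Omega(pi)^T: its i-th row is the column Omega e_i, so its row space is
   H(pi) = Omega(pi) R^A, written as row vectors. *)
Definition OmegaT (p : perm_pair) : 'M[R]_d :=
  \matrix_(i, j) omega_val p (enum_val i) (enum_val j).

Definition Hbasis (p : perm_pair) := row_base (OmegaT p).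

(* Matrix of Theta|_{H(pi)} in the basis Hbasis (row-vector coordinates:
   a vector c *m B of H is sent to (c *m restr) *m B). *)
Definition restr (p : perm_pair) (T : 'M[R]_d) : 'M[R]_(\rank (OmegaT p)) :=
  Hbasis p *m T^T *m pinvmx (Hbasis p).

(* s_0 >= s_1 >= ... >= s_(n-1) >= 0 are the singular values of M, i.e.
   M = U diag(s) V with U, V orthogonal.  (0-based: sigma_i = s (i-1).) *)
Definition singular_values (n : nat) (M : 'M[R]_n) (s : nat -> R) : Prop :=
  [/\ forall i j : nat, (i <= j)%N -> (j < n)%N -> s j <= s i,
      forall i : nat, (i < n)%N -> 0 <= s i &
      exists U V : 'M[R]_n,
        [/\ U *m U^T = 1%:M, V *m V^T = 1%:M &
            M = U *m diag_mx (\row_(i < n) s i) *m V]].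

End Rauzy.

(* Main.v *)
(* Both row cycles of a permutation act on [H] as symplectic transvections. For a standard
   permutation, with first top letter [a] and last top letter [z], the loops based at it
   contain the positive and negative transvections along [h_z] and [h_a], which generate a
   copy of SL_2(N) on the plane they span, and, up to one of these two, the transvections
   along [h_y] for every other letter [y]. Huge elements of SL_2(N) are almost of rank one:
   inserting [h_y]-transvections between them and compressing along the dominating rank one
   part leaves transvections on the symplectic complement of the plane whose exponents can be
   adjusted freely, so that all real exponents are reached in the limit. A symplectic
   Gram-Schmidt process then provides transvections along the vectors [p_1], .., [p_(g-1)] of
   a Lagrangian frame, with arbitrary exponents [w_1], .., [w_(g-1)]. The resulting loops have
   the form [E D F + B] with [E], [F], [B] bounded independently of the diagonal matrix
   [D = diag (lambda, w_1, .., w_(g-1))], hence singular values comparable to the entries of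
   [D], which can be taken as far apart as desired. *)

Require Import Defs.
From HB Require Import structures.
From mathcomp Require Import all_boot all_order all_algebra.
From mathcomp Require Import reals sequences exp.
From mathcomp Require Import perm complex.
From mathcomp Require Import ring lra zify.
Import Order.TTheory GRing.Theory Num.Theory.
Set Implicit Arguments. Unset Strict Implicit. Unset Printing Implicit Defensive.
Local Open Scope ring_scope.

(** * Singular values of invertible real matrices *)

(** For a letter [y] other than [a] and [z], the loops at hand act as [T_y^-1 T_z] and as
    [T_y T_a^-1], with imposed signs and extra factors that cannot be inverted inside the monoid.
    Compression frees the exponents: insert [T_y^-1] before [T_z^m T_a^-k T_z] and let [k] tend to
    infinity; eliminating the dominating rank one part leaves the exponent [-(m + 1) / (3 m - 1)]
    along the projection of [h_y], and exchanging the rows gives the opposite values. Two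
    consecutive values of [m] differ by [4 / ((3 m - 1) (3 m + 2))], with either sign, so multiples
    of these differences come close to every real number. Uniformity is the other difficulty, since
    reaching given weights may take very long products. The dominating column of a product is, up to
    a small error, that of its left factor, and its dominating row is always close to [a - z];
    neither multiplication nor passing to the limit degrades the bounds. The weights occur only in a
    block that is moved into [D], so everything else is bounded before they are chosen. The order
    is: constants, then weights, then a large [lambda]. *)

Lemma mul11mx (R : comPzRingType) p (x : 'M[R]_1) (v : 'M[R]_(1, p)) : x *m v = x 0 0 *: v.
Proof. by rewrite {1}[x]mx11_scalar mul_scalar_mx. Qed.

Section Svd.
Variable R : rcfType.

(** Over the complex numbers an eigenvalue [l] exists; evaluating [v C w], with [w] the conjugate
    transpose of [v], from both sides gives [l = l^*]. A real eigenvalue of the complexified matrix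
    is one of [A], hence has a real eigenvector. *)
Lemma symmetric_eigenvector n (A : 'M[R]_n.+1) : A^T = A ->
  exists (a : R) (v : 'rV_n.+1), v != 0 /\ v *m A = a *: v.
Proof.
move=> symA; pose C := map_mx (real_complex R) A.
have [l lC] := eigenvalue_closed C (ltn0Sn n).
suff [a la] : exists a : R, l = real_complex R a.
  have : eigenvalue A a by move: lC; rewrite la -(eigenvalue_map (real_complex R)).
  by case/eigenvalueP=> v vA v0; exists a, v.
have [v vC v0] := eigenvalueP lC.
pose w := map_mx Num.conj v^T.
have wC : C *m w = (l^*)%R *: w.
  have := congr1 (fun M => map_mx Num.conj M^T) vC.
  rewrite trmx_mul map_mxM linearZ /= map_mxZ -/w => <-; congr (_ *m _).
  by apply/matrixP=> i j; rewrite !mxE -[in LHS]symA mxE conj_Creal // complex_real.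
have s0 : (v *m w) 0 0 != 0.
  rewrite mxE psumr_eq0; last by move=> i _; rewrite !mxE mul_conjC_ge0.
  apply: contraNN v0 => /allP vv; apply/eqP/rowP => i; rewrite !mxE.
  by have := vv i (mem_index_enum i); rewrite !mxE mul_conjC_eq0 => /eqP.
have := congr1 (fun M : 'M_1 => M 0 0) (mulmxA v C w).
rewrite vC wC -scalemxAl -scalemxAr mxE [in RHS]mxE => /(mulIf s0) /CrealP.
by case/complex_realP=> a ->; exists a.
Qed.

Definition orthomx n (U : 'M[R]_n) := U *m U^T = 1%:M.

Lemma orthomx_tr n (U : 'M[R]_n) : orthomx U -> U^T *m U = 1%:M.
Proof. exact: mulmx1C. Qed.

Lemma orthomxM n (U V : 'M[R]_n) : orthomx U -> orthomx V -> orthomx (U *m V).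
Proof. by rewrite /orthomx => UU VV; rewrite trmx_mul mulmxA -[U *m V *m _]mulmxA VV mulmx1. Qed.

Lemma dotrv_gt0 n (v : 'rV[R]_n) : v != 0 -> 0 < (v *m v^T) 0 0.
Proof.
move=> v0; rewrite lt_def mxE; apply/andP; split; last first.
  by apply: sumr_ge0 => i _; rewrite mxE -expr2 sqr_ge0.
rewrite psumr_eq0 => [|i _]; last by rewrite mxE -expr2 sqr_ge0.
apply: contraNN v0 => /allP vv; apply/eqP/rowP => i; rewrite [RHS]mxE.
by have := vv i (mem_index_enum i); rewrite mxE mulf_eq0 orbb => /eqP.
Qed.

Lemma reflection_orthomx n (w : 'rV[R]_n) : w != 0 ->
  orthomx (1%:M - (2 / (w *m w^T) 0 0) *: (w^T *m w)).
Proof.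
move=> /dotrv_gt0; set s := (w *m w^T) 0 0 => s0.
rewrite /orthomx raddfB /= trmx1 [(_ *: _)^T]linearZ /= trmx_mul trmxK.
rewrite mulmxBl mul1mx mulmxBr mulmx1 -scalemxAl -scalemxAr.
rewrite -mulmxA [w *m (_ *m _)]mulmxA mul11mx -/s -scalemxAr.
apply/matrixP => i j; rewrite !mxE; set a := \sum_(_ < _) _ * _.
by field; rewrite gt_eqF.
Qed.

(** The reflection exchanging [v] and the first basis vector [e]. Its axis [v - e] vanishes when the
    two coincide, whence the separate case. *)
Lemma householder n (v : 'rV[R]_n.+1) : (v *m v^T) 0 0 = 1 ->
  exists H : 'M[R]_n.+1, orthomx H /\ row 0 H = v.
Proof.
move=> v1; pose e : 'rV[R]_n.+1 := delta_mx 0 0.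
have [->|ve] := eqVneq v e.
  by exists 1%:M; rewrite /orthomx trmx1 mulmx1 row1.
pose w := v - e.
have w0 : w != 0 by rewrite subr_eq0.
have := dotrv_gt0 w0; set s := (w *m w^T) 0 0 => s0.
have letter_unit : (e *m v^T) 0 0 = v 0 0 by rewrite -rowE !mxE.
have ve' : (v *m e^T) 0 0 = v 0 0 by rewrite trmx_delta -colE mxE.
have ee : (e *m e^T) 0 0 = 1 by rewrite -rowE !mxE !eqxx.
have sE : s = 2 - 2 * v 0 0.
  rewrite /s /w linearB /= mulmxBl !mulmxBr !mxE.
  by move: letter_unit ve' ee v1; rewrite !mxE => -> -> -> ->; ring.
have ew : (e *m w^T) 0 0 = v 0 0 - 1.
  by rewrite /w linearB /= mulmxBr mxE letter_unit mxE ee.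
exists (1%:M - (2 / s) *: (w^T *m w)); split; last first.
  rewrite rowE mulmxBr mulmx1 -scalemxAr mulmxA mul11mx ew scalerA.
  have -> : v 0 0 - 1 = - s / 2 by rewrite sE; field.
  have -> : 2 / s * (- s / 2) = -1 by field; rewrite gt_eqF.
  by rewrite scaleN1r opprK /w addrC subrK.
exact: reflection_orthomx.
Qed.

(** Deflation: with a unit eigenvector as first row of [H], the first row of [H A H^T] is a multiple
    of the first basis vector, and symmetry clears the first column too. *)
Lemma symmetric_diagonalization n (A : 'M[R]_n) : A^T = A ->
  exists (U : 'M[R]_n) (d : 'rV[R]_n), orthomx U /\ A = U^T *m diag_mx d *m U.
Proof.
elim: n A => [|n IHn] A symA.
  by exists 1%:M, 0; split; [rewrite /orthomx trmx1 mulmx1 | rewrite flatmx0 [RHS]flatmx0].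
have [a [v [v0 vA]]] := symmetric_eigenvector symA.
have vv0 := dotrv_gt0 v0.
pose u := (Num.sqrt ((v *m v^T) 0 0))^-1 *: v.
have uA : u *m A = a *: u by rewrite -scalemxAl vA !scalerA mulrC.
have uu : (u *m u^T) 0 0 = 1.
  rewrite linearZ /= -scalemxAl -scalemxAr scalerA mxE -invfM -expr2 sqr_sqrtr ?ltW//.
  by rewrite mulVf // gt_eqF.
have [H [oH rH]] := householder uu.
have [B defB] : exists B, B = H *m A *m H^T by exists (H *m A *m H^T).
have symB : B^T = B by rewrite defB !trmx_mul trmxK symA mulmxA.
have B0 j : B 0 j = a * (0 == j)%:R.
  have -> : B 0 j = (row 0 B) 0 j by rewrite [RHS]mxE.
  rewrite defB !row_mul rH uA -rH -scalemxAl -row_mul oH.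
  by rewrite !mxE.
pose B' : 'M_(1 + n) := B.
have symB' : (drsubmx B')^T = drsubmx B' by rewrite trmx_drsub symB.
have [U [d [oU dU]]] := IHn _ symB'.
have BE : B' = block_mx a%:M 0 0 (drsubmx B').
  rewrite -{1}[B']submxK; congr block_mx; apply/matrixP => i j.
  - by rewrite !ord1 !mxE lshift0 B0 !eqxx mulr1.
  - by rewrite !ord1 !mxE lshift0 B0 /= mulr0.
  - by rewrite !ord1 !mxE -[LHS]/(B _ _) -symB mxE lshift0 B0 /= mulr0.
pose V : 'M_(1 + n) := block_mx 1%:M 0 0 U.
pose d' : 'rV_(1 + n) := row_mx a%:M d.
have oV : orthomx V.
  rewrite /orthomx /V tr_block_mx !trmx0 trmx1 mulmx_block oU.
  by rewrite !mulmx1 !mulmx0 !mul0mx !addr0 add0r -scalar_mx_block.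
have BV : B' = V^T *m diag_mx d' *m V.
  rewrite BE dU /V tr_block_mx !trmx0 trmx1 diag_mx_row !mulmx_block.
  rewrite !mulmx1 !mul1mx !mulmx0 !mul0mx !addr0 !add0r.
  by rewrite mul0mx; congr block_mx; apply/matrixP=> i j; rewrite !mxE !ord1.
exists (V *m H), d'; split; first exact: orthomxM.
have HH := orthomx_tr oH.
rewrite trmx_mul -!mulmxA [_ *m (V *m H)]mulmxA [V^T *m _]mulmxA [V^T *m _]mulmxA -BV.
by rewrite /B' defB !mulmxA HH mul1mx -mulmxA HH mulmx1.
Qed.

Lemma perm_nonincreasing n (f : 'I_n -> R) :
  exists s : 'S_n, forall i j : 'I_n, (i <= j)%N -> f (s j) <= f (s i).
Proof.
pose t := [tuple f i | i < n].
have sz : size (sort >=%O t) == n by rewrite size_sort size_tuple.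
have : perm_eq (Tuple sz) t by rewrite perm_sort.
case/tuple_permP => s sE; exists s => i j ij.
have sf k : f (s k) = nth 0 (Tuple sz) k.
  by rewrite sE -tnth_nth !tnth_mktuple.
rewrite !sf; apply: (@sorted_leq_nth _ >=%O) => //.
- by move=> x y z yx zx; apply: le_trans zx yx.
- by move=> x; exact: lexx.
- exact: (sort_sorted (@ge_total _ _)).
- by rewrite inE (eqP sz).
- by rewrite inE (eqP sz).
Qed.

(** The [s i] are the square roots of the sorted eigenvalues of [M M^T]; invertibility makes them
    positive, so that [diag(1/s) U^T M] can serve as the second orthogonal factor. *)
Lemma singular_values_unitmx n (M : 'M[R]_n) : M \in unitmx ->
  exists (s : nat -> R) (U V : 'M[R]_n),
    [/\ forall i j : nat, (i <= j)%N -> (j < n)%N -> s j <= s i,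
        forall i : nat, (i < n)%N -> 0 < s i,
        orthomx U, orthomx V & M = U *m diag_mx (\row_(i < n) s i) *m V].
Proof.
move=> uM.
have symA : (M *m M^T)^T = M *m M^T by rewrite trmx_mul trmxK.
have [W [d [oW dW]]] := symmetric_diagonalization symA.
have [p pd] := perm_nonincreasing (d 0).
have [U defU] : exists U, U = (perm_mx p *m W)^T by exists (perm_mx p *m W)^T.
have oUt : orthomx U^T.
  by rewrite defU trmxK; apply: orthomxM => //; rewrite /orthomx tr_perm_mx -perm_mxM mulgV perm_mx1.
have oU : orthomx U by rewrite /orthomx -{1}[U]trmxK; apply: orthomx_tr.
have AU : U^T *m (M *m M^T) *m U = diag_mx (\row_j d 0 (p j)).
  have WW := oW; rewrite /orthomx in WW.
  rewrite dW defU trmxK trmx_mul !mulmxA -[_ *m W *m W^T]mulmxA WW mulmx1.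
  rewrite -[_ *m W *m W^T]mulmxA WW mulmx1.
  by apply/matrixP => i j; rewrite tr_perm_mx -row_permE -col_permE !mxE (inj_eq perm_inj).
have d0 i : 0 < d 0 (p i).
  have -> : d 0 (p i) = (U^T *m (M *m M^T) *m U) i i by rewrite AU !mxE eqxx.
  pose v := row i (U^T *m M).
  have -> : (U^T *m (M *m M^T) *m U) i i = (v *m v^T) 0 0.
    have -> : U^T *m (M *m M^T) *m U = (U^T *m M) *m (U^T *m M)^T.
      by rewrite trmx_mul trmxK !mulmxA.
    by rewrite !mxE; apply: eq_bigr => k _; rewrite !mxE.
  apply: dotrv_gt0; apply/eqP => v0.
  have uUM : U^T *m M \in unitmx.
    by rewrite unitmx_mul uM andbT; case/mulmx1_unit: oUt.
  have := congr1 (fun z => z *m invmx (U^T *m M)) v0.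
  rewrite /v rowE mulmxK // mul0mx => /rowP/(_ i); rewrite !mxE !eqxx => /eqP.
  by rewrite oner_eq0.
(* The default value 0 only serves the indices from [n] on. *)
pose s k := oapp (fun i : 'I_n => Num.sqrt (d 0 (p i))) 0 (insub k).
have sE (i : 'I_n) : s i = Num.sqrt (d 0 (p i)) by rewrite /s valK.
have s0 (i : 'I_n) : 0 < s i by rewrite sE sqrtr_gt0.
pose ds := diag_mx (\row_(i < n) (s i)^-1).
have dsd : ds *m diag_mx (\row_j d 0 (p j)) *m ds = 1%:M.
  rewrite !mulmx_diag; apply/matrixP => i j; rewrite !mxE; congr (_ *+ _).
  by rewrite -[d 0 _]sqr_sqrtr ?ltW // -sE; field; rewrite gt_eqF.
exists s, U, (ds *m U^T *m M); split=> //.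
- move=> k l kl ln; rewrite -[k]/(val (Ordinal (leq_ltn_trans kl ln))) -[l]/(val (Ordinal ln)).
  by rewrite !sE ler_wsqrtr // pd.
- by move=> k kn; apply: (s0 (Ordinal kn)).
- rewrite /orthomx !trmx_mul trmxK !mulmxA /ds tr_diag_mx.
  by move: dsd; rewrite -AU !mulmxA.
rewrite !mulmxA -[U *m _ *m ds]mulmxA.
have -> : diag_mx (\row_(i < n) s i) *m ds = 1%:M.
  rewrite mulmx_diag; apply/matrixP => i j; rewrite !mxE.
  by rewrite mulfV // gt_eqF.
by rewrite mulmx1 oU mul1mx.
Qed.
End Svd.

(** * Entrywise norm of rectangular matrices *)

Section EntrywiseNorm.
Variable R : realFieldType.

(** This norm is submultiplicative for rectangular matrices of all sizes and additive on blocks,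
    which suits factorisations of varying shapes. *)
Definition nrm m n (A : 'M[R]_(m, n)) : R := \sum_i \sum_j `|A i j|.

Lemma nrm_ge0 m n (A : 'M[R]_(m, n)) : 0 <= nrm A.
Proof. by apply: sumr_ge0 => i _; apply: sumr_ge0. Qed.

Lemma ler_nrm m n (A : 'M[R]_(m, n)) i j : `|A i j| <= nrm A.
Proof.
rewrite /nrm (bigD1 i) //= (bigD1 j) //= -addrA lerDl addr_ge0 //; first exact: sumr_ge0.
by apply: sumr_ge0 => k _; apply: sumr_ge0.
Qed.

Lemma nrm_gt0 m n (A : 'M[R]_(m, n)) : A != 0 -> 0 < nrm A.
Proof.
move=> A0; rewrite lt_def nrm_ge0 andbT; apply: contraNneq A0 => A0.
by apply/eqP/matrixP => i j; apply/eqP; rewrite mxE -normr_le0 -A0 ler_nrm.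
Qed.

Lemma nrmN m n (A : 'M[R]_(m, n)) : nrm (- A) = nrm A.
Proof. by apply: eq_bigr => i _; apply: eq_bigr => j _; rewrite mxE normrN. Qed.

Lemma nrmZ m n a (A : 'M[R]_(m, n)) : nrm (a *: A) = `|a| * nrm A.
Proof.
rewrite mulr_sumr; apply: eq_bigr => i _; rewrite mulr_sumr.
by apply: eq_bigr => j _; rewrite mxE normrM.
Qed.

Lemma nrmD m n (A B : 'M[R]_(m, n)) : nrm (A + B) <= nrm A + nrm B.
Proof.
rewrite -big_split; apply: ler_sum => i _; rewrite -big_split; apply: ler_sum => j _.
by rewrite mxE ler_normD.
Qed.

Lemma nrmB m n (A B : 'M[R]_(m, n)) : nrm (A - B) <= nrm A + nrm B.
Proof. by rewrite -(nrmN B) nrmD. Qed.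

Lemma nrm_tr m n (A : 'M[R]_(m, n)) : nrm A^T = nrm A.
Proof. by rewrite /nrm exchange_big; do 2!apply: eq_bigr => ? _; rewrite mxE. Qed.

Lemma nrmM m n p (A : 'M[R]_(m, n)) (B : 'M[R]_(n, p)) : nrm (A *m B) <= nrm A * nrm B.
Proof.
rewrite mulr_suml; apply: ler_sum => i _.
apply: (@le_trans _ _ (\sum_j \sum_k `|A i j| * `|B j k|)).
  rewrite exchange_big; apply: ler_sum => k _; rewrite mxE.
  by apply: le_trans (ler_norm_sum _ _ _) _; apply: ler_sum => j _; rewrite normrM.
rewrite mulr_suml; apply: ler_sum => j _; rewrite -mulr_sumr ler_wpM2l //.
rewrite [leRHS](bigD1 j) //= lerDl; apply: sumr_ge0 => k _; exact: sumr_ge0.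
Qed.

Lemma nrmM_le m n p a b (A : 'M[R]_(m, n)) (B : 'M[R]_(n, p)) :
  nrm A <= a -> nrm B <= b -> nrm (A *m B) <= a * b.
Proof. by move=> Aa Bb; apply: le_trans (nrmM _ _) _; apply: ler_pM; rewrite ?nrm_ge0. Qed.

Lemma nrmD_le m n a b (A B : 'M[R]_(m, n)) :
  nrm A <= a -> nrm B <= b -> nrm (A + B) <= a + b.
Proof. by move=> Aa Bb; apply: le_trans (nrmD _ _) _; apply: lerD. Qed.

Lemma nrm11 (x : 'M[R]_1) : nrm x = `|x 0 0|.
Proof. by rewrite /nrm !big_ord1. Qed.

Lemma nrm_col_mx m1 m2 n (A : 'M[R]_(m1, n)) (B : 'M[R]_(m2, n)) :
  nrm (col_mx A B) = nrm A + nrm B.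
Proof.
rewrite /nrm big_split_ord /=; congr (_ + _);
by do 2!apply: eq_bigr => ? _; rewrite ?col_mxEu ?col_mxEd.
Qed.

Lemma nrm_row_mx m n1 n2 (A : 'M[R]_(m, n1)) (B : 'M[R]_(m, n2)) :
  nrm (row_mx A B) = nrm A + nrm B.
Proof. by rewrite -nrm_tr tr_row_mx nrm_col_mx !nrm_tr. Qed.

Lemma nrm_mul_diag_le n (v d : 'rV[R]_n) c :
  (forall j, v 0 j != 0 -> `|d 0 j| <= c) -> nrm (v *m diag_mx d) <= c * nrm v.
Proof.
move=> dc; rewrite /nrm !big_ord1 mulr_sumr; apply: ler_sum => j _.
rewrite mul_mx_diag mxE normrM mulrC; have [->|/dc dj] := eqVneq (v 0 j) 0.
  by rewrite normr0 !mulr0.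
exact: ler_wpM2r.
Qed.

Lemma nrm_mul_diag_ge n (v d : 'rV[R]_n) c :
  (forall j, v 0 j != 0 -> c <= `|d 0 j|) -> c * nrm v <= nrm (v *m diag_mx d).
Proof.
move=> dc; rewrite /nrm !big_ord1 mulr_sumr; apply: ler_sum => j _.
rewrite mul_mx_diag mxE normrM [leRHS]mulrC; have [->|/dc dj] := eqVneq (v 0 j) 0.
  by rewrite normr0 !mulr0.
exact: ler_wpM2r.
Qed.

(** There are [i + 1] free coordinates for [i] equations; [pid_mx] selects both. *)
Lemma small_left_kernel n r (A : 'M[R]_(n, r)) i : (i < n)%N ->
  exists v : 'rV[R]_n, [/\ v != 0, forall j : 'I_n, (i < j)%N -> v 0 j = 0 &
    forall l : 'I_r, (l < i)%N -> (v *m A) 0 l = 0].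
Proof.
move=> ltin; pose p : 'M[R]_(i.+1, n) := pid_mx i.+1.
pose q : 'M[R]_(r, i) := pid_mx i.
have /rowV0Pn [x /sub_kermxP xB x0] : kermx (p *m A *m q) != 0.
  rewrite -mxrank_eq0 mxrank_ker subn_eq0 -ltnNge ltnS.
  exact: rank_leq_col.
exists (x *m p); split.
- apply: contraNneq x0 => /rowP xp; apply/eqP/rowP => a.
  have := xp (widen_ord ltin a); rewrite !mxE (bigD1 a) //= big1 => [|b ba].
    by rewrite mxE /= ltn_ord andbT; case: eqP => // _; rewrite mulr1 addr0.
  by rewrite mxE /= (negPf (_ : (b : nat) != a)) ?mulr0 //; apply: contraNneq ba => /val_inj ->.
- move=> j ij; rewrite mxE big1 // => a _; rewrite mxE.
  by rewrite ltn_eqF ?mulr0 // (leq_trans (ltn_ord a)).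
- move=> l li; have := congr1 (fun z : 'rV_i => z 0 (Ordinal li)) xB.
  rewrite !mulmxA mxE [RHS]mxE (bigD1 l) //= big1 => [|b bl].
    by rewrite [q _ _]mxE /= li andbT; case: eqP => // _; rewrite mulr1 addr0.
  by rewrite [q _ _]mxE /= (negPf (_ : (b : nat) != l)) ?mulr0 //; apply: contraNneq bl => /val_inj ->.
Qed.

End EntrywiseNorm.

Lemma nrm_orthomx_le (R : rcfType) n (U : 'M[R]_n) : orthomx U -> nrm U <= (n * n)%:R.
Proof.
move=> oU; have -> : (n * n)%:R = \sum_(i < n) \sum_(j < n) (1 : R).
  by rewrite !sumr_const !card_ord -mulrnA.
apply: ler_sum => i _; apply: ler_sum => j _.
rewrite -(expr_le1 (n := 2)) // real_normK ?num_real //.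
have <- : (U *m U^T) i i = 1 by rewrite oU mxE eqxx.
rewrite mxE (bigD1 j) //= mxE -expr2 lerDl; apply: sumr_ge0 => k _.
by rewrite mxE -expr2 sqr_ge0.
Qed.

(* The spectrum of [M = E D F + B] is that of the diagonal [D] up to constants: intersect the
   span of [i + 1] singular directions with the kernel of [i] linear forms. *)
Section SingularValueBounds.
Variables (R : rcfType) (n r : nat) (M U V : 'M[R]_n) (s : nat -> R).
Hypothesis s_mono : forall i j : nat, (i <= j)%N -> (j < n)%N -> s j <= s i.
Hypothesis s_gt0 : forall i : nat, (i < n)%N -> 0 < s i.
Hypotheses (oU : orthomx U) (oV : orthomx V) (ME : M = U *m diag_mx (\row_(i < n) s i) *m V).
Variables (E F' : 'M[R]_(n, r)) (F E' : 'M[R]_(r, n)) (D : 'rV[R]_r) (B : 'M[R]_n) (K : R).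
Hypotheses (MD : M = E *m diag_mx D *m F + B).
Hypotheses (E'E : E' *m E = 1%:M) (FF' : F *m F' = 1%:M).
Hypotheses (nE : nrm E <= K) (nF : nrm F <= K) (nE' : nrm E' <= K) (nF' : nrm F' <= K).
Hypotheses (nB : nrm B <= K) (nK : (n * n)%:R <= K).
Hypothesis D_mono : forall i j : 'I_r, (i <= j)%N -> D 0 j <= D 0 i.
Hypothesis D_gt0 : forall i, 0 < D 0 i.

Let K0 : 0 <= K. Proof. exact: le_trans (ler0n _ _) nK. Qed.

(** [x M] is bounded below through [s i], as only the [i + 1] largest singular values act on [v],
    and above through [D 0 i], as [x E] misses the [i] largest entries of [D]. *)
Lemma singular_value_le (i : 'I_r) : (i < n)%N -> s i <= K ^+ 4 * D 0 i + K ^+ 3.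
Proof.
move=> ltin; have [v [v0 vs vE]] := small_left_kernel (U^T *m E) ltin.
pose x := v *m U^T.
have nv := nrm_gt0 v0.
have nx : nrm x <= nrm v * K.
  apply: nrmM_le => //; rewrite nrm_tr; exact: le_trans (nrm_orthomx_le oU) nK.
have xM : x *m M = v *m diag_mx (\row_(i < n) s i) *m V.
  by rewrite ME /x -!mulmxA [U^T *m _]mulmxA (orthomx_tr oU) mul1mx.
have nxM : nrm (x *m M) <= nrm x * K * (D 0 i * K) + nrm x * K.
  rewrite MD mulmxDr; apply: nrmD_le; last exact: nrmM_le.
  rewrite !mulmxA mulrA; apply: nrmM_le => //.
  rewrite [leRHS]mulrC; apply: (@le_trans _ _ (D 0 i * nrm (x *m E))); last first.
    by rewrite ler_pM2l //; apply: nrmM_le.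
  apply: nrm_mul_diag_le => j xj; rewrite gtr0_norm //; apply: D_mono.
  by rewrite leqNgt; apply: contraNN xj => ji; rewrite /x -mulmxA vE.
have : s i * nrm v <= nrm (x *m M) * K.
  apply: (@le_trans _ _ (nrm (x *m M *m V^T))).
    rewrite xM -mulmxA oV mulmx1; apply: nrm_mul_diag_ge => j vj.
    rewrite mxE gtr0_norm ?s_gt0 //; apply: s_mono => //.
    by rewrite leqNgt; apply: contraNN vj => ji; rewrite vs.
  by apply: nrmM_le => //; rewrite nrm_tr; exact: le_trans (nrm_orthomx_le oV) nK.
move=> sv; rewrite -(ler_pM2r nv); apply: le_trans sv _.
have c0 : 0 <= K * (D 0 i * K) + K by rewrite addr_ge0 ?mulr_ge0 // ltW.
apply: (@le_trans _ _ (nrm v * K * (K * (D 0 i * K) + K) * K)); last first.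
  by rewrite le_eqVlt; apply/orP; left; apply/eqP; ring.
apply: ler_wpM2r => //; apply: le_trans nxM _; rewrite -mulrA -mulrDr.
exact: ler_wpM2r.
Qed.

(** The mirror argument: [v] lives on the [i + 1] largest entries of [D], [y = v E'] avoids the [i]
    largest singular directions, and [E'], [F'] recover [v D] from [y M] up to the bounded term
    [B]. *)
Lemma singular_value_ge (i : 'I_r) : (i < n)%N -> D 0 i <= K ^+ 4 * s i + K ^+ 3.
Proof.
move=> ltin; have [v [v0 vs vE]] := small_left_kernel (E' *m U) (ltn_ord i).
pose y := v *m E'.
have nv := nrm_gt0 v0.
have ny : nrm y <= nrm v * K by exact: nrmM_le.
have nyM : nrm (y *m M) <= s i * (nrm y * K) * K.
  rewrite ME !mulmxA; apply: nrmM_le; last exact: le_trans (nrm_orthomx_le oV) nK.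
  apply: (@le_trans _ _ (s i * nrm (y *m U))); last first.
    rewrite ler_pM2l ?s_gt0 //; apply: nrmM_le => //.
    exact: le_trans (nrm_orthomx_le oU) nK.
  apply: nrm_mul_diag_le => j yj; rewrite mxE gtr0_norm ?s_gt0 //; apply: s_mono => //.
  by rewrite leqNgt; apply: contraNN yj => ji; rewrite /y -mulmxA vE.
have vD : v *m diag_mx D = y *m M *m F' - y *m B *m F'.
  rewrite MD -mulmxBl mulmxDr addrK /y !mulmxA -[v *m _ *m E]mulmxA E'E mulmx1.
  by rewrite -!mulmxA FF' mulmx1.
have : D 0 i * nrm v <= s i * (nrm y * K) * K * K + nrm y * K * K.
  apply: (@le_trans _ _ (nrm (v *m diag_mx D))).
    apply: nrm_mul_diag_ge => j vj; rewrite gtr0_norm //; apply: D_mono.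
    by rewrite leqNgt; apply: contraNN vj => ji; rewrite vs.
  rewrite vD; apply: nrmD_le; rewrite ?nrmN; apply: nrmM_le => //.
  exact: nrmM_le.
move=> sv; rewrite -(ler_pM2r nv); apply: le_trans sv _.
have c0 : 0 <= s i * K ^+ 3 + K ^+ 2 by rewrite addr_ge0 ?mulr_ge0 ?exprn_ge0 // ltW ?s_gt0.
apply: (@le_trans _ _ (nrm v * K * (s i * K ^+ 3 + K ^+ 2))); last first.
  by rewrite le_eqVlt; apply/orP; left; apply/eqP; ring.
apply: (@le_trans _ _ (nrm y * (s i * K ^+ 3 + K ^+ 2))).
  by rewrite le_eqVlt; apply/orP; left; apply/eqP; ring.
exact: ler_wpM2r.
Qed.

End SingularValueBounds.

(** * Weights far enough apart *)

Section Weights.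
Variables (R : realType) (K C : R).
Hypotheses (K_gt0 : 0 < K) (C_gt0 : 0 < C).

(** [base] and [next] compensate the loss in passing from [D] to the singular values, which are only
    known up to [K ^+ 4] and [K ^+ 3]. The [+ 1] in the exponents makes the final inequalities
    strict, and the summand [x] of [next] makes the sequence of weights monotone. *)
Let base : R := K ^+ 4 * expR (C + 1) + K ^+ 3 + 1.
Let next (x : R) : R := x + K ^+ 4 * expR (C * ln (K ^+ 4 * x + K ^+ 3) + 1) + K ^+ 3.

Let next_ge x : x <= next x.
Proof. by rewrite /next -addrA lerDl addr_ge0 ?mulr_ge0 ?exprn_ge0 ?expR_ge0 // ltW. Qed.

Let base_gt0 : 0 < base.
Proof. by rewrite /base ltr_wpDl // addr_ge0 ?mulr_ge0 ?exprn_ge0 ?expR_ge0 // ltW. Qed.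

Let iter_next_mono m k : (m <= k)%N -> iter m next base <= iter k next base.
Proof.
move=> /subnK <-; elim: (k - m)%N => // j IH.
by rewrite addSn iterS; apply: le_trans IH (next_ge _).
Qed.

Let ln_ge x y s : K ^+ 4 * expR x + K ^+ 3 <= y -> y <= K ^+ 4 * s + K ^+ 3 -> x <= ln s.
Proof.
move=> xy ys; have := le_trans xy ys; rewrite lerD2r ler_pM2l ?exprn_gt0 // => xs.
by rewrite -[x]expRK ler_ln ?posrE ?expR_gt0 //; apply: lt_le_trans xs; rewrite expR_gt0.
Qed.

(** The first entry is only bounded below: the dominating factor of a loop can be made large but not
    prescribed. *)
Lemma pinching_weights r : exists (w : 'rV[R]_r) (L : R), forall l, L <= l ->
  let D : 'rV[R]_(1 + r) := row_mx l%:M w in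
  [/\ forall i j : 'I_(1 + r), (i <= j)%N -> D 0 j <= D 0 i,
      forall i, 0 < D 0 i &
      forall s : nat -> R, (forall i : 'I_(1 + r), [/\ 0 < s i,
        s i <= K ^+ 4 * D 0 i + K ^+ 3 & D 0 i <= K ^+ 4 * s i + K ^+ 3]) ->
      C < ln (s r) /\ forall i, (1 <= i)%N -> (i <= r)%N -> C * ln (s i) < ln (s i.-1)].
Proof.
(* Entry [j] of [w] is entry [j.+1] of [D]; going up one rank applies [next] once more, starting
   from [base] at rank [r]. *)
exists (\row_(j < r) iter (r - j.+1) next base), (iter r next base) => l Ll D.
have DE (i : 'I_(1 + r)) : D 0 i = if i == 0%N :> nat then l else iter (r - i) next base.
  rewrite /D mxE; case: splitP => j ->; first by rewrite !ord1 mxE eqxx.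
  by rewrite mxE.
have D_ge (i : 'I_(1 + r)) : iter (r - i) next base <= D 0 i.
  by rewrite DE; case: eqP => // ->; rewrite subn0.
split.
- move=> i j ij; rewrite [leLHS]DE; case: eqP => [j0|_].
    by rewrite DE; move: ij; rewrite j0 leqn0 => ->.
  by apply: le_trans (D_ge i); apply: iter_next_mono; lia.
- by move=> i; apply: lt_le_trans (D_ge i); apply: lt_le_trans (iter_next_mono (leq0n _)).
move=> s sD; split.
  have [_ _ Ds] := sD ord_max.
  apply: (@lt_le_trans _ _ (C + 1)); first by rewrite ltrDl.
  apply: (ln_ge _ Ds); apply: le_trans (D_ge _); rewrite subnn /= /base.
  by rewrite lerDl.
move=> i i1 ir; have ir1 : (i < 1 + r)%N by rewrite add1n ltnS.
have [s0 sle _] := sD (Ordinal ir1).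
have ip : (i.-1 < 1 + r)%N by exact: leq_ltn_trans (leq_pred _) ir1.
have [_ _ sge] := sD (Ordinal ip).
have Di : D 0 (Ordinal ir1) = iter (r - i) next base by rewrite DE /= gtn_eqF.
have Dp : next (D 0 (Ordinal ir1)) <= D 0 (Ordinal ip).
  by apply: le_trans (D_ge _); rewrite Di /= (_ : r - i.-1 = (r - i).+1)%N //; lia.
apply: (@lt_le_trans _ _ (C * ln (K ^+ 4 * D 0 (Ordinal ir1) + K ^+ 3) + 1)).
  apply: (@le_lt_trans _ _ (C * ln (K ^+ 4 * D 0 (Ordinal ir1) + K ^+ 3))); last by rewrite ltrDl.
  rewrite ler_pM2l // ler_ln ?posrE //; exact: lt_le_trans sle.
apply: (ln_ge _ sge); apply: le_trans Dp; rewrite /next -addrA lerDr.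
by rewrite Di; apply: le_trans (iter_next_mono (leq0n _)); apply: ltW.
Qed.

End Weights.

(** * Symplectic transvections and compression of a monoid *)

Section Transvections.
Variables (R : realFieldType) (n : nat) (J : 'M[R]_n).
Hypothesis J_skew : J^T = - J.

Definition sform (x y : 'rV[R]_n) : R := (x *m J *m y^T) 0 0.

Lemma omDl x y z : sform (x + y) z = sform x z + sform y z.
Proof. by rewrite /sform !mulmxDl mxE. Qed.

Lemma omZl a x y : sform (a *: x) y = a * sform x y.
Proof. by rewrite /sform -!scalemxAl mxE. Qed.

Lemma omNl x y : sform (- x) y = - sform x y.
Proof. by rewrite -scaleN1r omZl mulN1r. Qed.

Lemma om_skew x y : sform x y = - sform y x.
Proof.
rewrite /sform; have -> : x *m J *m y^T = - (y *m J *m x^T)^T; last by rewrite !mxE.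
by rewrite !trmx_mul trmxK J_skew mulNmx mulmxN opprK mulmxA.
Qed.

Lemma omxx x : sform x x = 0.
Proof. by have := om_skew x x; lra. Qed.

Lemma omDr x y z : sform x (y + z) = sform x y + sform x z.
Proof. by rewrite om_skew omDl opprD -!om_skew. Qed.

Lemma omZr a x y : sform x (a *: y) = a * sform x y.
Proof. by rewrite om_skew omZl -mulrN -om_skew. Qed.

Lemma omNr x y : sform x (- y) = - sform x y.
Proof. by rewrite -scaleN1r omZr mulN1r. Qed.

Definition omE := (omDl, omZl, omNl, omDr, omZr, omNr, omxx).

Definition transvec (v : 'rV[R]_n) (m : R) : 'M[R]_n := 1%:M + m *: (J *m v^T *m v).

Lemma mul_rank1 x v (w : 'rV[R]_n) : x *m (J *m v^T *m w) = sform x v *: w.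
Proof. by rewrite !mulmxA mul11mx. Qed.

Lemma mul_tv x v m : x *m transvec v m = x + (m * sform x v) *: v.
Proof. by rewrite mulmxDr mulmx1 -scalemxAr mul_rank1 scalerA. Qed.

End Transvections.

Lemma row_ext (R : pzRingType) m n (A B : 'M[R]_(m, n)) :
  (forall x : 'rV_m, x *m A = x *m B) -> A = B.
Proof. by move=> AB; apply/row_matrixP => i; rewrite !rowE. Qed.

Lemma tvD (R : realFieldType) n (J : 'M[R]_n) v m m' : J^T = - J ->
  transvec J v m *m transvec J v m' = transvec J v (m + m').
Proof.
move=> J_skew; apply: row_ext => x; rewrite mulmxA !mul_tv !(omE J_skew).
by apply/rowP => j; rewrite !mxE; ring.
Qed.

(** The monomials are those of the error terms in a product of two compressed elements. Dividing by
    the product of the four sizes, all at least 1, bounds them together, and 16 leaves room for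
    adding them up. *)
Lemma small_step (R : realFieldType) (g g' k q e : R) :
  1 <= g -> 1 <= g' -> 1 <= k -> 1 <= q -> 0 < e -> exists d w,
  [/\ 0 < d, 16 * w <= 1 /\ 16 * w <= e,
    [/\ d <= w, g * d <= w, g' * d <= w, k * d <= w & q * d <= w] &
    [/\ g * k * d <= w, g * k * q * d <= w & g * g' * k * d <= w]].
Proof.
move=> g1 g1' k1 q1 e0; pose W := g * g' * k * q; pose m := Num.min 1 e.
have W0 : 0 < W by rewrite /W !mulr_gt0 // (lt_le_trans ltr01).
have m0 : 0 < m by rewrite lt_min ltr01.
exists (m / (16 * W)), (W * (m / (16 * W))).
have d0 : 0 < m / (16 * W) by rewrite divr_gt0 // mulr_gt0.
have -> : 16 * (W * (m / (16 * W))) = m by field; rewrite gt_eqF.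
have le01 (z : R) : 1 <= z -> 0 <= 1 <= z by move=> z1; rewrite ler01.
have le0z (z : R) : 1 <= z -> 0 <= z <= z by move=> z1; rewrite lexx (le_trans ler01).
have W_ge (x y z t : R) : 0 <= x <= g -> 0 <= y <= g' -> 0 <= z <= k -> 0 <= t <= q ->
    x * y * z * t * (m / (16 * W)) <= W * (m / (16 * W)).
  move=> /andP[? ?] /andP[? ?] /andP[? ?] /andP[? ?].
  by rewrite ler_wpM2r ?(ltW d0) // !ler_pM ?mulr_ge0.
split=> //; first by rewrite !ge_min !lexx orbT.
- split.
  + by have := W_ge 1 1 1 1; rewrite !mul1r; apply; apply: le01.
  + by have := W_ge g 1 1 1; rewrite !mulr1; apply; solve [exact: le01|exact: le0z].
  + by have := W_ge 1 g' 1 1; rewrite !mul1r !mulr1; apply; solve [exact: le01|exact: le0z].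
  + by have := W_ge 1 1 k 1; rewrite !mul1r !mulr1; apply; solve [exact: le01|exact: le0z].
  + by have := W_ge 1 1 1 q; rewrite !mul1r; apply; solve [exact: le01|exact: le0z].
- split.
  + by have := W_ge g 1 k 1; rewrite !mulr1; apply; solve [exact: le01|exact: le0z].
  + by have := W_ge g 1 k q; rewrite !mulr1; apply; solve [exact: le01|exact: le0z].
  + by have := W_ge g g' k 1; rewrite !mulr1; apply; solve [exact: le01|exact: le0z].
Qed.

Section Attainable.
Variables (R : realFieldType) (n : nat) (NN : 'M[R]_n -> Prop) (pr : 'rV[R]_n).
Hypothesis NN_mul : forall P Q, NN P -> NN Q -> NN (P *m Q).

(* [G] is the block that survives when elements [lambda b c + S] of [NN], with [lambda]
   large and [c] close to [pr], are compressed along their dominating rank one part. *)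
Definition attained (K : R) (G : 'M[R]_n) := pr *m G = 0 /\
  forall e : R, 0 < e -> exists (P : 'M[R]_n) (l : R) (b : 'cV[R]_n) (c : 'rV[R]_n) (S : 'M[R]_n),
    [/\ NN P, P = l *: (b *m c) + S, e^-1 <= l &
      [/\ nrm b <= K + e, `|(pr *m b) 0 0 - 1| <= e, nrm (c - pr) <= e & nrm (S - G) <= e]].

(** With [u = c b'], which is close to [pr b'] and hence to 1, the cross terms of the product are
    absorbed by completing [l l' u b c']: [b] moves by [S b' / (l u)] and [c'] by [c S' / (l' u)].
    The price is the term [S b' c S' / u], small because [c S'] is close to [pr G' = 0]. The column
    stays close to that of the left factor, so the constant [K] is kept. *)
Lemma att_mul (K K' : R) G G' : 0 <= K' -> attained K G -> attained K' G' -> attained K (G *m G').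
Proof.
move=> K'0 [prG aG] [prG' aG']; split=> [|e e0]; first by rewrite mulmxA prG mul0mx.
have bound (x : R) : 0 <= x -> exists y, 1 <= y /\ x + 1 <= y.
  by move=> x0; exists (x + 1); rewrite lerDr.
have [g [g1 Gg]] := bound _ (nrm_ge0 G); have [g' [g1' Gg']] := bound _ (nrm_ge0 G').
have [k [k1 Kk]] := bound _ K'0; have [q [q1 prq]] := bound _ (nrm_ge0 pr).
have [d [w [d0 [w1 we] [dw gd gd' kd qd] [gkd gkqd ggkd]]]] := small_step g1 g1' k1 q1 e0.
have [P [l [b [c [S [NP PE dl [nb prb nc nS]]]]]]] := aG d d0.
have [P' [l' [b' [c' [S' [NP' PE' dl' [nb' prb' nc' nS']]]]]]] := aG' d d0.
have d1 : d <= 1 by clear - dw d0 w1; lra.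
have nSg : nrm S <= g.
  by have := nrmD_le nS (lexx (nrm G)); rewrite subrK; clear - Gg d1; lra.
have nSg' : nrm S' <= g'.
  by have := nrmD_le nS' (lexx (nrm G')); rewrite subrK; clear - Gg' d1; lra.
have Gg_ : nrm G <= g by clear - Gg; lra.
have prq_ : nrm pr <= q by clear - prq; lra.
have nbk' : nrm b' <= k by clear - nb' Kk d1; lra.
pose u := (c *m b') 0 0.
have uE : `|u - 1| <= 2 * (w).
  have -> : u - 1 = ((c - pr) *m b') 0 0 + ((pr *m b') 0 0 - 1).
    by rewrite mulmxBl /u !mxE; ring.
  apply: le_trans (ler_normD _ _) _.
  have : `|((c - pr) *m b') 0 0| <= d * k by rewrite -nrm11; apply: nrmM_le.
  by rewrite mulrC; clear - kd dw prb'; lra.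
have u12 : 1 / 2 <= u by move: uE; rewrite ler_norml => /andP[]; clear - w1; lra.
have u0 : 0 < u by clear - u12; lra.
have ui : `|u^-1| <= 2.
  rewrite gtr0_norm ?invr_gt0 // -[2]invrK lef_pV2 ?posrE ?invr_gt0 //; clear - u12; lra.
have l0 : 0 < l by apply: lt_le_trans dl; rewrite invr_gt0.
have l0' : 0 < l' by apply: lt_le_trans dl'; rewrite invr_gt0.
have li : `|l^-1| <= d by rewrite gtr0_norm ?invr_gt0 // -[d]invrK lef_pV2 ?posrE ?invr_gt0.
have li' : `|l'^-1| <= d by rewrite gtr0_norm ?invr_gt0 // -[d]invrK lef_pV2 ?posrE ?invr_gt0.
have nSb : nrm (S *m b') <= g * k by exact: nrmM_le.
have ncS : nrm (c *m S') <= g' * d + q * d.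
  have -> : c *m S' = (c - pr) *m S' + pr *m (S' - G').
    by rewrite mulmxBl mulmxBr prG' subr0 subrK.
  by apply: nrmD_le; [rewrite mulrC|]; apply: nrmM_le.
exists (P *m P'), (l * l' * u), (b + (l^-1 * u^-1) *: (S *m b')),
  (c' + (l'^-1 * u^-1) *: (c *m S')), (S *m S' - u^-1 *: (S *m b' *m (c *m S'))).
have nbb : nrm ((l^-1 * u^-1) *: (S *m b')) <= 2 * (g * k * d).
  have -> : 2 * (g * k * d) = d * 2 * (g * k) by ring.
  by rewrite nrmZ normrM ler_pM // ?mulr_ge0 ?nrm_ge0 // ler_pM.
split.
- exact: NN_mul.
- have -> : P *m P' = l *: (l' *: (u *: (b *m c'))) + l *: (b *m (c *m S'))
      + (l' *: (S *m b' *m c') + S *m S').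
    rewrite PE PE' mulmxDl !mulmxDr -!scalemxAl -!scalemxAr !mulmxA.
    by rewrite -[b *m c *m b']mulmxA [c *m b']mx11_scalar -/u mul_mx_scalar -scalemxAl.
  move: (S *m b') (c *m S') (S *m S') => B C SS.
  apply/matrixP => i j; rewrite !mxE !big_ord1 !mxE.
  by field; rewrite !gt_eqF.
- have el : e^-1 <= d^-1 by rewrite lef_pV2 ?posrE //; clear - d0 dw we; lra.
  have l2 : 2 <= l' by apply: le_trans dl'; rewrite -[2]invrK lef_pV2 ?posrE ?invr_gt0 //;
    clear - d0 dw w1; lra.
  apply: le_trans el _; apply: le_trans dl _; rewrite -mulrA ler_pMr //.
  have : 2 * (1 / 2) <= l' * u by apply: ler_pM; rewrite ?divr_ge0.
  by rewrite mul1r divff ?pnatr_eq0.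
split.
- by apply: le_trans (nrmD_le nb nbb) _; clear - d0 dw we gkd; lra.
- rewrite mulmxDr mxE addrAC; apply: le_trans (ler_normD _ _) _.
  have : `|(pr *m ((l^-1 * u^-1) *: (S *m b'))) 0 0| <= q * (2 * (g * k * d)).
    by rewrite -nrm11; apply: nrmM_le.
  have -> : q * (2 * (g * k * d)) = 2 * (g * k * q * d) by ring.
  by clear - prb d0 dw we gkqd; lra.
- have n2 : nrm ((l'^-1 * u^-1) *: (c *m S')) <= d * 2 * (g' * d + q * d).
    by rewrite nrmZ normrM; apply: ler_pM; [rewrite mulr_ge0|exact: nrm_ge0|apply: ler_pM|exact: ncS].
  have h : d * 2 * (g' * d + q * d) <= d * 2 * 1.
    by rewrite ler_pM2l ?mulr_gt0 //; clear - gd' qd w1; lra.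
  rewrite addrAC; apply: le_trans (nrmD_le nc' n2) _.
  by clear - h d0 dw w1 we; lra.
- have -> : S *m S' - u^-1 *: (S *m b' *m (c *m S')) - G *m G' =
     (S - G) *m S' + G *m (S' - G') - u^-1 *: (S *m b' *m (c *m S')).
    by rewrite mulmxBl mulmxBr [in RHS]addrA subrK addrAC.
  have n1 : nrm ((S - G) *m S') <= d * g' by exact: nrmM_le.
  have n2 : nrm (G *m (S' - G')) <= g * d by exact: nrmM_le.
  have n3 : nrm (u^-1 *: (S *m b' *m (c *m S'))) <= 2 * (g * k * (g' * d + q * d)).
    by rewrite nrmZ ler_pM ?nrm_ge0 //; apply: nrmM_le.
  apply: le_trans (nrmB _ _) _; apply: le_trans (lerD (nrmD_le n1 n2) n3) _.
  have -> : 2 * (g * k * (g' * d + q * d)) = 2 * (g * g' * k * d) + 2 * (g * k * q * d) by ring.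
  by rewrite [d * g']mulrC; clear - gd' gd ggkd gkqd d0 dw we; lra.
Qed.

Lemma att_closed (K : R) G : pr *m G = 0 ->
  (forall e : R, 0 < e -> exists G', attained K G' /\ nrm (G' - G) <= e) -> attained K G.
Proof.
move=> prG aG; split=> // e e0; have e2 : 0 < e / 2 by rewrite divr_gt0.
have [G' [[_ /(_ _ e2) [P [l [b [c [S [NP PE el [nb prb nc nS]]]]]]]] GG]] := aG _ e2.
exists P, l, b, c, S; split=> //.
  by apply: le_trans el; rewrite lef_pV2 ?posrE //; lra.
split; try lra.
rewrite -[S - G](subrKA G'); apply: le_trans (nrmD_le nS GG) _; lra.
Qed.

End Attainable.

(* The Schur complement of a one-parameter family whose dominating part is of rank one. *)
Lemma att_family (R : archiRealFieldType) n (NN : 'M[R]_n -> Prop) (pr : 'rV[R]_n)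
    (K : R) (b0 b1 : 'cV[R]_n) (c1 : 'rV[R]_n) (S0 S1 : 'M[R]_n) :
  0 < (pr *m b0) 0 0 -> nrm b0 <= K * (pr *m b0) 0 0 ->
  (forall k : nat, (0 < k)%N -> NN (k%:R *: ((b0 + k%:R^-1 *: b1) *m (pr + k%:R^-1 *: c1))
     + (S0 + k%:R^-1 *: S1))) ->
  attained NN pr K (S0 - ((pr *m b0) 0 0)^-1 *: (b0 *m (pr *m S0))).
Proof.
set D0 := (pr *m b0) 0 0 => D00 b0K NNk; split=> [|e e0].
  rewrite mulmxBr -scalemxAr (mulmxA pr b0) [pr *m b0]mx11_scalar -/D0 mul_scalar_mx scalerA.
  by rewrite mulVf ?scale1r ?subrr // gt_eqF.
pose D1 := (pr *m b1) 0 0.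
(* [z], [x2], [x3] and [x4] are the coefficients of [h = 1/k] in the bounds for [b], [1/l], [c] and
   [S], while [x1] ensures that [D] stays above [D0 / 2]; [k] is chosen so that [h] times their sum
   is at most [m]. *)
pose z := 2 / D0 ^+ 2 * (D0 * nrm b1 + `|D1| * nrm b0).
pose q := nrm pr; pose s := nrm S0 + nrm S1.
pose x1 := 2 * `|D1| / D0; pose x2 := 2 / D0.
pose x3 := nrm c1 + 2 / D0 * (q * s).
pose x4 := nrm S1 + (z * (q * s) + K * (q * nrm S1)).
have K0 : 0 <= K by rewrite -(pmulr_lge0 _ D00); apply: le_trans (nrm_ge0 _) b0K.
have D0i : 0 <= 2 / D0 by rewrite divr_ge0 // ltW.
have z0 : 0 <= z.
  by rewrite mulr_ge0 ?divr_ge0 ?exprn_ge0 ?addr_ge0 ?mulr_ge0 ?nrm_ge0 ?normr_ge0 // ltW.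
have q0 : 0 <= q by exact: nrm_ge0.
have s0 : 0 <= s by rewrite addr_ge0 ?nrm_ge0.
have x10 : 0 <= x1 by rewrite divr_ge0 ?mulr_ge0 // ltW.
have x20 : 0 <= x2 by [].
have x30 : 0 <= x3 by apply: addr_ge0; [exact: nrm_ge0|apply: mulr_ge0 => //; exact: mulr_ge0].
have x40 : 0 <= x4.
  apply: addr_ge0 (nrm_ge0 _) _; apply: addr_ge0; first exact: mulr_ge0 z0 (mulr_ge0 q0 s0).
  exact: mulr_ge0 K0 (mulr_ge0 q0 (nrm_ge0 _)).
pose m := Num.min 1 e.
have m0 : 0 < m by rewrite lt_min ltr01.
pose X := z + x1 + x2 + x3 + x4.
have X0 : 0 <= X by apply: addr_ge0 x40; apply: addr_ge0 x30; apply: addr_ge0 x20; exact: addr_ge0.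
pose k := (Num.bound (X / m)).+1; pose h : R := k%:R^-1.
have kn : (0 < k)%N by [].
have k0 : 0 < k%:R :> R by rewrite ltr0n.
have h0 : 0 < h by rewrite invr_gt0.
have h1 : h <= 1 by rewrite invf_le1 // ler1n.
have hX : h * X <= m.
  rewrite mulrC ler_pdivrMr // mulrC -ler_pdivrMr //.
  apply: le_trans (ltW (archi_boundP _)) _; first by rewrite divr_ge0 // ltW.
  by rewrite ler_nat.
have hx x : x <= X -> h * x <= m by move=> xX; apply: le_trans hX; rewrite ler_pM2l.
have hz : h * z <= m by apply: hx; rewrite /X; lra.
have hx1 : h * x1 <= m by apply: hx; rewrite /X; lra.
have hx2 : h * x2 <= m by apply: hx; rewrite /X; lra.
have hx3 : h * x3 <= m by apply: hx; rewrite /X; lra.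
have hx4 : h * x4 <= m by apply: hx; rewrite /X; lra.
have m1 : m <= 1 by rewrite ge_min lexx.
have me : m <= e by rewrite ge_min lexx orbT.
clear hx hX X0; clearbody m k X.
pose D := D0 + h * D1.
have D_ge : D0 / 2 <= D.
  have : h * `|D1| <= D0 / 2.
    have := le_trans hx1 m1; rewrite /x1.
    have -> : h * (2 * `|D1| / D0) = h * `|D1| / (D0 / 2) by field; rewrite gt_eqF.
    by rewrite ler_pdivrMr ?divr_gt0 // mul1r.
  have := ler_norm (- D1); rewrite normrN -(ler_pM2l h0) /D; lra.
have Dgt0 : 0 < D by apply: lt_le_trans D_ge; rewrite divr_gt0.
have Di : D^-1 <= 2 / D0.
  by rewrite -[2 / D0]invrK lef_pV2 ?posrE ?invr_gt0 ?divr_gt0 // invf_div.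
pose b := D^-1 *: (b0 + h *: b1); pose bl := D0^-1 *: b0.
have prb : (pr *m (b0 + h *: b1)) 0 0 = D by rewrite mulmxDr -scalemxAr mxE [X in _ + X]mxE.
have bE : b - bl = h *: ((D0 * D)^-1 *: (D0 *: b1 - D1 *: b0)).
  by apply/matrixP => i j; rewrite !mxE /D; field; rewrite !gt_eqF.
have nbl : nrm bl <= K.
  by rewrite nrmZ gtr0_norm ?invr_gt0 // ler_pdivrMl // mulrC.
have nbb : nrm (b - bl) <= h * z.
  rewrite bE nrmZ gtr0_norm // ler_pM2l // nrmZ gtr0_norm ?invr_gt0 ?mulr_gt0 //.
  apply: ler_pM; [by rewrite invr_ge0 mulr_ge0 // ltW|exact: nrm_ge0| |].
    have -> : 2 / D0 ^+ 2 = D0^-1 * (2 / D0) by field; rewrite gt_eqF.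
    by rewrite invfM ler_pM2l ?invr_gt0.
  by apply: le_trans (nrmB _ _) _; rewrite !nrmZ (gtr0_norm D00).
have nSh : nrm (S0 + h *: S1) <= s.
  by apply: nrmD_le => //; rewrite nrmZ gtr0_norm // ler_piMl ?nrm_ge0.
have nqs : nrm (pr *m (S0 + h *: S1)) <= q * s by exact: nrmM_le.
(* The column is normalised by [pr b = 1], and the part [b (pr S)] of the remainder is moved into
   the row, where it only weighs [h / D]; what is left is killed by [pr]. *)
exists (k%:R *: ((b0 + h *: b1) *m (pr + h *: c1)) + (S0 + h *: S1)), (k%:R * D), b,
  (pr + h *: (c1 + D^-1 *: (pr *m (S0 + h *: S1)))),
  (S0 + h *: S1 - b *m (pr *m (S0 + h *: S1))).
split.
- exact: NNk.
- rewrite /b; move: (S0 + h *: S1) (b0 + h *: b1) => S' b'; move: (pr *m S') => w.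
  rewrite -!scalemxAl; apply/matrixP => i j; rewrite !mxE !big_ord1 !mxE /h.
  by field; rewrite !gt_eqF.
- have -> : e^-1 = e^-1 * 1 by rewrite mulr1.
  rewrite -[k%:R]invrK -/h ler_pdivrMl // mulrCA ler_pdivlMl // mulr1.
  move: (le_trans hx2 me); have -> : h * x2 = h / (D0 / 2) by rewrite /x2; field; rewrite gt_eqF.
  by rewrite ler_pdivrMr ?divr_gt0 // => he; apply: le_trans he _; rewrite ler_pM2l.
split.
- by rewrite -[b](subrK bl) addrC; apply: nrmD_le => //; lra.
- by rewrite /b -scalemxAr mxE prb mulVf ?gt_eqF // subrr normr0 ltW.
- rewrite addrAC subrr add0r nrmZ gtr0_norm //; apply: le_trans (le_trans hx3 me).
  rewrite ler_pM2l //; apply: nrmD_le => //; rewrite nrmZ gtr0_norm ?invr_gt0 //.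
  by apply: ler_pM; rewrite ?nrm_ge0 ?invr_ge0 // ltW.
have -> : S0 + h *: S1 - b *m (pr *m (S0 + h *: S1)) - (S0 - D0^-1 *: (b0 *m (pr *m S0))) =
   h *: S1 - ((b - bl) *m (pr *m (S0 + h *: S1)) + h *: (bl *m (pr *m S1))).
  rewrite /bl; have -> : pr *m (S0 + h *: S1) = pr *m S0 + h *: (pr *m S1).
    by rewrite mulmxDr -scalemxAr.
  move: (pr *m S0) (pr *m S1) => y1 y2; apply/matrixP => i j.
  by rewrite !mxE !big_ord1 !mxE; ring.
apply: le_trans (le_trans hx4 me); apply: le_trans (nrmB _ _) _; rewrite mulrDr.
apply: lerD; first by rewrite nrmZ gtr0_norm.
rewrite mulrDr; apply: nrmD_le; first by rewrite mulrA; apply: nrmM_le.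
by rewrite nrmZ gtr0_norm // ler_pM2l //; do 2!apply: nrmM_le => //.
Qed.

(** When [sform J a z = -1], this is the projection onto the symplectic complement of the plane of
    [a] and [z], acting on row vectors. *)
Definition plproj (R : realFieldType) n (J : 'M[R]_n) (a z : 'rV[R]_n) : 'M[R]_n :=
  1%:M + J *m z^T *m a - J *m a^T *m z.

Lemma mul_plproj (R : realFieldType) n (J : 'M[R]_n) (a z x : 'rV[R]_n) :
  x *m plproj J a z = x + sform J x z *: a - sform J x a *: z.
Proof. by rewrite mulmxBr mulmxDr mulmx1 !mul_rank1. Qed.

(** * Compression along a plane carrying transvections of both signs *)

Section Plane.
Variables (R : archiRealFieldType) (n : nat) (J : 'M[R]_n) (NN : 'M[R]_n -> Prop).
Hypothesis J_skew : J^T = - J.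
Hypothesis NN_mul : forall P Q, NN P -> NN Q -> NN (P *m Q).
Variables (a z : 'rV[R]_n).
Hypothesis om_az : sform J a z = -1.
Hypotheses (NNz : NN (transvec J z 1)) (NNa : NN (transvec J a (-1))).

Let om_za : sform J z a = 1. Proof. by rewrite om_skew // om_az opprK. Qed.
Let eJ := omE J_skew.
Let K0 := nrm (J *m z^T) + nrm (J *m a^T).
Let pr := a - z.

Lemma NN_tv_nat v m k : NN (transvec J v m) -> (0 < k)%N -> NN (transvec J v (k%:R * m)).
Proof.
move=> Nv; elim: k => // -[_ _|k IH _]; first by rewrite mul1r.
by rewrite -addn1 natrD mulrDl mul1r -tvD //; apply: NN_mul => //; apply: IH.
Qed.

Lemma om_plproj x v : sform J (x *m plproj J a z) v = sform J x (v *m plproj J a z).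
Proof.
rewrite !mul_plproj !eJ (om_skew J_skew a v) (om_skew J_skew z v); ring.
Qed.

(* In the coordinates [(a, -z)] the three factors are [[1, m; 0, 1]], [[1, 0; k, 1]], [[1, 1; 0, 1]]. *)
Let word (m k : nat) := transvec J z m%:R *m transvec J a (- k%:R) *m transvec J z 1.

Let NN_word m k : (0 < m)%N -> (0 < k)%N -> NN (word m k).
Proof.
move=> m0 k0; apply: NN_mul => //; apply: NN_mul.
  by rewrite -[m%:R]mulr1; apply: NN_tv_nat.
by rewrite -[k%:R]mulr1 -mulrN; apply: NN_tv_nat.
Qed.

Let b0 (m : nat) := - (m%:R *: (J *m z^T) + J *m a^T).
Let b1 := - (J *m z^T).
Let S1 := - (J *m z^T *m z).

(** The dominating row is [a - z] whatever [m], which only tilts the column. The last factor of the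
    word is there for this: [a - z] merely changes sign when [a] and [z] are exchanged, so that both
    signs of the exponents are compressed along the same row. *)
Let wordE m k : (0 < k)%N -> word m k =
  k%:R *: ((b0 m + k%:R^-1 *: b1) *m (pr + k%:R^-1 *: - z)) + (plproj J a z + k%:R^-1 *: S1).
Proof.
move=> k0; apply: row_ext => x; rewrite /word !mulmxA !mul_tv.
set b := b0 m + _; set c := pr + _.
rewrite mulmxDr -[x *m (_ *: (b *m c))]scalemxAr mulmxA [x *m (plproj _ _ _ + _)]mulmxDr.
rewrite mul_plproj -[x *m (_ *: S1)]scalemxAr.
have -> : x *m S1 = - (sform J x z *: z) by rewrite mulmxN mul_rank1.
have -> : x *m b = (- ((m%:R + k%:R^-1) * sform J x z + sform J x a))%:M.
  rewrite mulmxDr -scalemxAr !mulmxN mulmxDr -scalemxAr !mulmxA.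
  rewrite [x *m J *m z^T]mx11_scalar [x *m J *m a^T]mx11_scalar -/(sform J x z) -/(sform J x a).
  by apply/matrixP=> i j; rewrite !ord1 !mxE !eqxx !mulr1n; ring.
rewrite mul_scalar_mx !eJ om_za om_az /c /pr.
have kn : k%:R != 0 :> R by rewrite pnatr_eq0 -lt0n.
by apply/rowP => j; rewrite !mxE; field.
Qed.

Let pr_b0 m : (pr *m b0 m) 0 0 = m%:R + 1.
Proof.
rewrite mulmxN mulmxDr -scalemxAr !mulmxA.
rewrite [pr *m J *m z^T]mx11_scalar [pr *m J *m a^T]mx11_scalar -/(sform J pr z) -/(sform J pr a).
by rewrite !mxE !eqxx !mulr1n /pr !eJ om_az om_za; ring.
Qed.

Let pr_plproj : pr *m plproj J a z = 0.
Proof. by rewrite mul_plproj !eJ om_az om_za; apply/rowP => j; rewrite !mxE; ring. Qed.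

Let nrm_b0 m : (0 < m)%N -> nrm (b0 m) <= K0 * m%:R.
Proof.
move=> m0; rewrite nrmN mulrDl mulrC; apply: nrmD_le; first by rewrite nrmZ normr_nat mulrC.
by rewrite ler_peMr ?nrm_ge0 // ler1n.
Qed.

Lemma att_plproj : attained NN pr K0 (plproj J a z).
Proof.
have -> : plproj J a z = plproj J a z - ((pr *m b0 1) 0 0)^-1 *: (b0 1 *m (pr *m plproj J a z)).
  by rewrite pr_plproj mulmx0 scaler0 subr0.
apply: (@att_family _ _ _ _ _ _ b1 (- z) _ S1); rewrite ?pr_b0 ?addr_gt0 //.
  apply: le_trans (nrm_b0 (ltn0Sn 0)) _; rewrite ler_wpM2l ?addr_ge0 ?nrm_ge0 //; lra.
by move=> k k0; rewrite -wordE //; apply: NN_word.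
Qed.

(** Since [pr T = pr + 2 y], [pr b0 = m + 1] and [y b0 = m - 1], the Schur complement divides by
    [3 m - 1]. It corrects the exponent [-1] of [T] by [2 (m - 1) / (3 m - 1)], which leaves
    [-(m + 1) / (3 m - 1)]. *)
Lemma att_transvection y m : sform J a y = -1 -> sform J z y = 1 ->
  NN (transvec J y (-1) *m transvec J z 1) -> (0 < m)%N ->
  let v := y *m plproj J a z in
  attained NN pr K0 (plproj J a z - ((m%:R + 1) / (3 * m%:R - 1)) *: (J *m v^T *m v)).
Proof.
move=> om_ay om_zy NNy m0 v; set T := transvec J y (-1).
have m0' : 0 < m%:R :> R by rewrite ltr0n.
have m1 : 1 <= m%:R :> R by rewrite ler1n.
have vE : v = y - a - z.
  rewrite /v mul_plproj (om_skew J_skew y z) (om_skew J_skew y a) om_ay om_zy.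
  by apply/rowP => j; rewrite !mxE; ring.
have om_ya : sform J y a = 1 by rewrite om_skew // om_ay opprK.
have om_yz : sform J y z = -1 by rewrite om_skew // om_zy.
have prT : pr *m T = pr + 2 *: y.
  by rewrite mul_tv /pr !eJ om_ay om_zy; apply/rowP => j; rewrite !mxE; ring.
have yb0 : y *m b0 m = (m%:R - 1)%:M.
  rewrite mulmxN mulmxDr -scalemxAr !mulmxA.
  rewrite [y *m J *m z^T]mx11_scalar [y *m J *m a^T]mx11_scalar -/(sform J y z) -/(sform J y a).
  by rewrite om_ya om_yz; apply/matrixP=> i j; rewrite !ord1 !mxE !eqxx !mulr1n; ring.
have prb0 : pr *m b0 m = (m%:R + 1)%:M by rewrite [LHS]mx11_scalar pr_b0.
have prTb0 : (pr *m (T *m b0 m)) 0 0 = 3 * m%:R - 1.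
  rewrite mulmxA prT mulmxDl -scalemxAl yb0 prb0 !mxE !eqxx !mulr1n; ring.
have D0 : 0 < 3 * m%:R - 1 :> R by lra.
(* [T] alone need not belong to [NN]: the factor [T_z] it requires is borrowed from the first power
   of the word, whence [0 < m]. *)
have NNTw k : (0 < k)%N -> NN (T *m word m k).
  move=> k0; case: m m0 {m0' m1 yb0 prb0 prTb0 D0} => // -[_|m' _].
    rewrite /word !mulmxA -mulmxA; apply: NN_mul => //; apply: NN_mul => //.
    by rewrite -[k%:R]mulr1 -mulrN; apply: NN_tv_nat.
  have -> : T *m word m'.+2 k = T *m transvec J z 1 *m word m'.+1 k.
    by rewrite /word -[m'.+2]add1n natrD -(tvD _ _ _ J_skew) !mulmxA.
  by apply: NN_mul => //; apply: NN_word.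
have aT : attained NN pr (nrm T * K0) (T *m plproj J a z
    - (3 * m%:R - 1)^-1 *: (T *m b0 m *m (pr *m (T *m plproj J a z)))).
  rewrite -prTb0; apply: (@att_family _ _ _ _ _ _ (T *m b1) (- z) _ (T *m S1)).
  - by rewrite prTb0.
  - rewrite prTb0 -mulrA; apply: nrmM_le => //; apply: le_trans (nrm_b0 m0) _.
    rewrite ler_wpM2l ?addr_ge0 ?nrm_ge0 //; lra.
  move=> k k0; have := NNTw k k0; rewrite (wordE m k0).
  have <- : T *m (b0 m + k%:R^-1 *: b1) = T *m b0 m + k%:R^-1 *: (T *m b1).
    by rewrite mulmxDr -scalemxAr.
  have <- : T *m (plproj J a z + k%:R^-1 *: S1) = T *m plproj J a z + k%:R^-1 *: (T *m S1).
    by rewrite mulmxDr -scalemxAr.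
  move: (b0 m + _) (pr + _) (plproj _ _ _ + _) => b c S.
  by rewrite mulmxDr -scalemxAr mulmxA.
have K00 : 0 <= nrm T * K0 by rewrite mulr_ge0 ?addr_ge0 ?nrm_ge0.
(* Multiplying by the compressed identity on the left projects the remaining [T], and also replaces
   the constant [nrm T * K0] by [K0], independent of [y]. *)
suff -> : plproj J a z - ((m%:R + 1) / (3 * m%:R - 1)) *: (J *m v^T *m v) =
  plproj J a z *m (T *m plproj J a z
    - (3 * m%:R - 1)^-1 *: (T *m b0 m *m (pr *m (T *m plproj J a z)))).
  exact: (att_mul NN_mul K00 att_plproj aT).
have -> : pr *m (T *m plproj J a z) = 2 *: v.
  by rewrite mulmxA prT mulmxDl pr_plproj add0r -scalemxAl.
apply: row_ext => x.
have plb0 : x *m plproj J a z *m b0 m = 0.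
  rewrite mulmxN mulmxDr -scalemxAr !mulmxA.
  set x' := x *m _; rewrite [x' *m J *m z^T]mx11_scalar [x' *m J *m a^T]mx11_scalar.
  rewrite -/(sform J x' z) -/(sform J x' a) /x' mul_plproj !eJ om_az om_za.
  by apply/matrixP=> i j; rewrite !ord1 !mxE !eqxx !mulr1n; ring.
have plpl : x *m plproj J a z *m plproj J a z = x *m plproj J a z.
  rewrite [LHS]mul_plproj mul_plproj !eJ om_az om_za.
  by apply/rowP=> j; rewrite !mxE; ring.
have plT : x *m plproj J a z *m T = x *m plproj J a z - sform J x v *: y.
  by rewrite mul_tv om_plproj -/v mulN1r scaleNr.
have : y *m plproj J a z = v by [].
move: (plproj J a z) plb0 plpl plT => p plb0 plpl plT yp.
rewrite mulmxBr -scalemxAr mul_rank1 mulmxA mulmxBr -scalemxAr !mulmxA.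
rewrite plT 2!mulmxBl plb0 plpl sub0r -!scalemxAl yb0 yp mulNmx -scalemxAl mul_scalar_mx.
by apply/rowP=> j; rewrite !mxE; field; lra.
Qed.

End Plane.

Lemma att_opp (R : realFieldType) n (NN : 'M[R]_n -> Prop) (pr : 'rV[R]_n) K G :
  attained NN (- pr) K G -> attained NN pr K G.
Proof.
move=> [prG aG]; split=> [|e e0].
  by apply/eqP; rewrite -oppr_eq0 -mulNmx prG.
have [P [l [b [c [S [NP PE el [nb prb nc nS]]]]]]] := aG e e0.
exists P, l, (- b), (- c), S; split=> //; first by rewrite mulNmx mulmxN opprK.
by split=> //; rewrite ?nrmN // ?mulmxN -?mulNmx // -opprD nrmN -[pr]opprK.
Qed.

Lemma tvN (R : realFieldType) n (J : 'M[R]_n) v m : transvec (- J) v m = transvec J v (- m).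
Proof. by rewrite /transvec !mulNmx scalerN scaleNr. Qed.

Lemma omNJ (R : realFieldType) n (J : 'M[R]_n) x y : sform (- J) x y = - sform J x y.
Proof. by rewrite /sform mulmxN mulNmx mxE. Qed.

Section Compression.
Variables (R : archiRealFieldType) (n : nat) (J : 'M[R]_n) (NN : 'M[R]_n -> Prop).
Hypothesis J_skew : J^T = - J.
Hypothesis NN_mul : forall P Q, NN P -> NN Q -> NN (P *m Q).
Variables (a z : 'rV[R]_n).
Hypothesis om_az : sform J a z = -1.
Hypotheses (NNz : NN (transvec J z 1)) (NNa : NN (transvec J a (-1))).

Let om_za : sform J z a = 1. Proof. by rewrite om_skew // om_az opprK. Qed.
Let eJ := omE J_skew.
Let p0 := plproj J a z.
Let K0 := nrm (J *m z^T) + nrm (J *m a^T).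
Let pr := a - z.
Let K00 : 0 <= K0. Proof. by rewrite addr_ge0 ?nrm_ge0. Qed.

Definition ctransvec (v : 'rV[R]_n) (m : R) := plproj J a z + m *: (J *m v^T *m v).

Let mul_ctv x v m : x *m ctransvec v m = x *m p0 + (m * sform J x v) *: v.
Proof. by rewrite mulmxDr -scalemxAr mul_rank1 scalerA. Qed.

Let om_p0 (x v : 'rV_n) : v *m p0 = v -> sform J (x *m p0) v = sform J x v.
Proof. by move=> vp; rewrite om_plproj // -/p0 vp. Qed.

Let p0K (x : 'rV_n) : x *m p0 *m p0 = x *m p0.
Proof.
rewrite [LHS]mul_plproj mul_plproj !eJ om_az om_za.
by apply/rowP=> j; rewrite !mxE; ring.
Qed.

Lemma pr_p0 : pr *m p0 = 0.
Proof. by rewrite mul_plproj !eJ om_az om_za; apply/rowP => j; rewrite !mxE; ring. Qed.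

Definition ctv_att (v : 'rV[R]_n) := v *m plproj J a z = v /\
  forall m, attained NN (a - z) (nrm (J *m z^T) + nrm (J *m a^T)) (ctransvec v m).

Lemma pr_ctv (v : 'rV_n) m : v *m p0 = v -> pr *m ctransvec v m = 0.
Proof.
move=> vp; rewrite mul_ctv pr_p0 add0r -[v in sform _ _ v]vp -om_plproj // -/p0 pr_p0.
by rewrite /sform mul0mx mul0mx mxE mulr0 scale0r.
Qed.

Let ctvD (v : 'rV_n) m m' : v *m p0 = v -> ctransvec v m *m ctransvec v m' = ctransvec v (m + m').
Proof.
move=> vp; apply: row_ext => x; rewrite mulmxA !mul_ctv mulmxDl p0K -scalemxAl vp.
by rewrite !eJ om_p0 //; apply/rowP => j; rewrite !mxE; ring.
Qed.

(** Sums of exponents are attained, so the differences of consecutive [rho k], which tend to 0, are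
    attained with both signs; their multiples approach every real number, and attained blocks are
    closed under limits. *)
Lemma ctv_att_letter y : sform J a y = -1 -> sform J z y = 1 ->
  NN (transvec J y (-1) *m transvec J z 1) -> NN (transvec J y 1 *m transvec J a (-1)) ->
  ctv_att (y *m plproj J a z).
Proof.
move=> om_ay om_zy NNy NNy'; set v := y *m _.
have vp : v *m p0 = v by exact: p0K.
split=> //.
pose rho (k : nat) : R := (k%:R + 1) / (3 * k%:R - 1).
have neg k : (0 < k)%N -> attained NN pr K0 (ctransvec v (- rho k)).
  by move=> k0; rewrite /ctransvec scaleNr; apply: att_transvection.
(* Replacing [J] by [- J] and exchanging [a] and [z] preserves the hypotheses, reverses the signs of
   the exponents and turns [pr] into its opposite. *)
have pos k : (0 < k)%N -> attained NN pr K0 (ctransvec v (rho k)).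
  move=> k0; have skew' : (- J)^T = - - J by rewrite [LHS]linearN /= J_skew.
  have := @att_transvection R n (- J) NN skew' NN_mul z a.
  rewrite !tvN opprK => att'; have := att' _ NNa NNz y k.
  rewrite !omNJ om_za om_zy om_ay opprK !tvN opprK.
  move=> /(_ erefl erefl erefl NNy' k0).
  have -> : plproj (- J) z a = p0.
    by rewrite /plproj !mulNmx opprK addrAC.
  have -> : z - a = - pr by rewrite opprB.
  have -> : nrm (- J *m a^T) + nrm (- J *m z^T) = K0 by rewrite !mulNmx !nrmN addrC.
  by rewrite -/v /= !mulNmx scalerN opprK => /att_opp.
have nat_mul (m : R) : attained NN pr K0 (ctransvec v m) ->
    forall j : nat, attained NN pr K0 (ctransvec v (j%:R * m)).
  move=> am; elim=> [|j IH]; first by rewrite mul0r /ctransvec scale0r addr0; apply: att_plproj.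
  by rewrite -addn1 natrD mulrDl mul1r -ctvD //; apply: (att_mul NN_mul K00 IH am).
have add (m m' : R) : attained NN pr K0 (ctransvec v m) -> attained NN pr K0 (ctransvec v m') ->
    attained NN pr K0 (ctransvec v (m + m')).
  by move=> am am'; rewrite -ctvD //; apply: (att_mul NN_mul K00 am am').
move=> m; apply: att_closed; first exact: pr_ctv.
move=> e e0; pose N := nrm (J *m v^T *m v) + 1.
have N0 : 0 < N by rewrite ltr_wpDl ?nrm_ge0.
pose k := (Num.bound (N / e)).+1.
have kN : N / e <= k%:R.
  apply: le_trans (ltW (archi_boundP _)) _; first by rewrite divr_ge0 // ltW.
  by rewrite ler_nat.
have k0 : (0 < k)%N by [].
have k1 : 1 <= k%:R :> R by rewrite ler1n.
clearbody k.
pose d := rho k - rho k.+1.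
have dE : d = 4 / ((3 * k%:R - 1) * (3 * k%:R + 2)).
  by rewrite /d /rho -addn1 natrD; field; apply/andP; split; lra.
have d0 : 0 < d by rewrite dE divr_gt0 // mulr_gt0 //; lra.
have dk : d <= k%:R^-1.
  rewrite dE ler_pdivrMr; last by rewrite mulr_gt0 //; lra.
  rewrite -ler_pdivrMl ?invr_gt0; last by lra.
  by rewrite invrK; nra.
have ad : attained NN pr K0 (ctransvec v d) by apply: add; [exact: pos|exact: neg].
have ad' : attained NN pr K0 (ctransvec v (- d)).
  by rewrite opprB addrC; apply: add; [exact: neg|exact: pos].
pose j := Num.truncn (`|m| / d).
have /andP[jm mj] : j%:R <= `|m| / d < j.+1%:R by rewrite truncn_itv // divr_ge0 // ltW.
have dN : d * N <= e.
  apply: le_trans (_ : k%:R^-1 * N <= e); first by rewrite ler_pM2r.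
  by rewrite ler_pdivrMl; [rewrite mulrC -ler_pdivrMl // mulrC|lra].
have jd : `| j%:R * d - `|m| | <= d.
  move: jm mj; rewrite ler_pdivlMr // ltr_pdivrMr // -addn1 natrD => jm mj.
  by rewrite ler_norml; lra.
have close m' : `|m' - m| <= d -> nrm (ctransvec v m' - ctransvec v m) <= e.
  move=> mm; have -> : ctransvec v m' - ctransvec v m = (m' - m) *: (J *m v^T *m v).
    by rewrite /ctransvec opprD addrACA subrr add0r scalerBl.
  rewrite nrmZ; apply: le_trans dN; apply: ler_pM; rewrite ?nrm_ge0 //.
  by rewrite lerDl.
have [m_ge|m_lt] := ger0P m.
  by exists (ctransvec v (j%:R * d)); split; [exact: nat_mul|apply: close; move: jd; rewrite (ger0_norm m_ge)].
exists (ctransvec v (j%:R * - d)); split; first exact: nat_mul.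
by apply: close; move: jd; rewrite (ltr0_norm m_lt) -normrN; congr (`| _ | <= _); ring.
Qed.

Lemma ctv_att_scale c v : ctv_att v -> ctv_att (c *: v).
Proof.
case=> vp av; split; first by rewrite -scalemxAl vp.
move=> m; have -> : ctransvec (c *: v) m = ctransvec v (m * c * c); last exact: av.
by rewrite /ctransvec [(c *: v)^T]linearZ /= -!scalemxAr -!scalemxAl !scalerA mulrA.
Qed.

(** Conjugating the transvection along [v] by one along [w] gives the transvection along the image
    of [v]. No inverse is lacking, since the exponent [- m] along [w] is attained as well. *)
Lemma ctv_att_conj v w m : ctv_att v -> ctv_att w -> ctv_att (v + (m * sform J v w) *: w).
Proof.
move=> [vp av] [wp aw]; split=> [|k].
  by rewrite mulmxDl vp -scalemxAl wp.
have -> : ctransvec (v + (m * sform J v w) *: w) k = ctransvec w (- m) *m ctransvec v k *m ctransvec w m.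
  apply: row_ext => x; rewrite !mulmxA !mul_ctv.
  rewrite !mulmxDl -!scalemxAl !p0K vp wp !eJ !om_p0 // (om_skew J_skew w v).
  by apply/rowP => j; rewrite !mxE; ring.
by apply: (att_mul NN_mul K00 _ (aw _)); apply: (att_mul NN_mul K00 (aw _) (av _)).
Qed.

Lemma ctv_att_lim v w : (forall e : R, 0 < e -> ctv_att (v + e *: w)) -> ctv_att v.
Proof.
move=> vw; have [v1p _] := vw 1 ltr01; have [v2p _] := vw 2 (ltr0Sn _ _).
have vp : v *m p0 = v.
  have -> : v = 2 *: (v + 1 *: w) - (v + 2 *: w).
    by apply/rowP => j; rewrite !mxE; ring.
  by rewrite mulmxBl -scalemxAl v1p v2p.
split=> // m; apply: att_closed => [|e e0]; first exact: pr_ctv.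
pose X := `|m| * (nrm (J *m v^T *m w) + nrm (J *m w^T *m v) + nrm (J *m w^T *m w)) + 1.
have X0 : 0 < X by rewrite ltr_wpDl // mulr_ge0 // !addr_ge0 ?nrm_ge0.
pose h := Num.min 1 (e / X).
have h0 : 0 < h by rewrite lt_min ltr01 divr_gt0.
have h1 : h <= 1 by rewrite ge_min lexx.
have hX : h * X <= e by rewrite -ler_pdivlMr // ge_min lexx orbT.
have [_ ah] := vw h h0; exists (ctransvec (v + h *: w) m); split=> //.
apply: le_trans hX.
have -> : ctransvec (v + h *: w) m - ctransvec v m =
    h *: (m *: (J *m v^T *m w + J *m w^T *m v + h *: (J *m w^T *m w))).
  rewrite /ctransvec opprD addrACA subrr add0r [(v + _)^T]linearD /= [(h *: w)^T]linearZ /=.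
  rewrite !(mulmxDr, mulmxDl) -!scalemxAr -!scalemxAl.
  by apply/matrixP => i j; rewrite !mxE; ring.
rewrite nrmZ (gtr0_norm h0) ler_pM2l // nrmZ.
apply: (@le_trans _ _ (`|m| * (nrm (J *m v^T *m w) + nrm (J *m w^T *m v) + nrm (J *m w^T *m w)))).
  rewrite ler_wpM2l //; do 2?apply: nrmD_le => //.
  by rewrite nrmZ (gtr0_norm h0) ler_piMl ?nrm_ge0.
by rewrite lerDl.
Qed.

End Compression.

(** * Symplectic Gram-Schmidt *)

Section SymplecticGramSchmidt.
Variables (R : realFieldType) (n : nat) (J : 'M[R]_n).
Hypothesis J_skew : J^T = - J.
Let eJ := omE J_skew.

Variable S : 'rV[R]_n -> Prop.
Hypothesis S_scale : forall c v, S v -> S (c *: v).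
Hypothesis S_conj : forall v w m, S v -> S w -> S (v + (m * sform J v w) *: w).
Hypothesis S_lim : forall v w, (forall e : R, 0 < e -> S (v + e *: w)) -> S v.

(* The transvection along [f + e x], where [f] is the component of [y] in the plane of
   [s] and [t] and [sform f x != 0], moves [y] within [O(e)] of its projection. *)
Lemma S_project s t y : S s -> S t -> sform J s t = 1 -> S y ->
  S (y - sform J y t *: s + sform J y s *: t).
Proof.
move=> Ss St st Sy; set v := y - _ + _.
have plane c d : S (c *: s + d *: t).
  have [->|c0] := eqVneq c 0; first by rewrite scale0r add0r; apply: S_scale.
  have -> : c *: s + d *: t = c *: (s + (d / c * sform J s t) *: t).
    by apply/rowP => j; rewrite !mxE st; field.
  by apply: S_scale; apply: S_conj.
pose c := sform J y t; pose d := - sform J y s.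
have yE : y = v + (c *: s + d *: t).
  by apply/rowP => j; rewrite /v /c /d !mxE; ring.
have ts : sform J t s = -1 by rewrite om_skew // st.
have vs : sform J v s = 0 by rewrite /v !eJ ts; ring.
have vt : sform J v t = 0 by rewrite /v !eJ st; ring.
clearbody c d v; have [f0|[c' [d' fx]]] : c *: s + d *: t = 0 \/
    exists c' d', sform J (c *: s + d *: t) (c' *: s + d' *: t) = 1.
- have [c0|c0] := eqVneq c 0.
    have [d0|d0] := eqVneq d 0; first by left; rewrite c0 d0 !scale0r addr0.
    by right; exists (- d^-1), 0; rewrite !eJ ts st; field.
  by right; exists 0, (c^-1); rewrite !eJ st ts; field.
- by move: Sy; rewrite {1}yE f0 addr0.
apply: (@S_lim _ (- (c' *: s + d' *: t))) => e e0.
have Sx : S ((c + e * c') *: s + (d + e * d') *: t) by [].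
have := S_conj (- e^-1) Sy Sx; congr S.
have -> : sform J y ((c + e * c') *: s + (d + e * d') *: t) = e * 1.
  rewrite -fx yE !eJ vs vt st ts; ring.
apply/rowP => j; rewrite {1}yE !mxE; field; rewrite gt_eqF //.
Qed.

(** For a symplectic frame, the component of [v] orthogonal to all of [P] and [Q]. *)
Definition sres r (P Q : 'M[R]_(r, n)) (v : 'rV[R]_n) :=
  v - v *m J *m Q^T *m P + v *m J *m P^T *m Q.

Definition sympl r (P Q : 'M[R]_(r, n)) :=
  [/\ P *m J *m Q^T = 1%:M, P *m J *m P^T = 0 & Q *m J *m Q^T = 0].

Lemma sform_skew r r' (P : 'M[R]_(r, n)) (Q : 'M[R]_(r', n)) :
  P *m J *m Q^T = - (Q *m J *m P^T)^T.
Proof. by rewrite !trmx_mul trmxK J_skew mulNmx mulmxN opprK mulmxA. Qed.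

Lemma sympl_QP r (P Q : 'M[R]_(r, n)) : sympl P Q -> Q *m J *m P^T = - 1%:M.
Proof. by case=> PQ _ _; rewrite sform_skew PQ trmx1. Qed.

Lemma mul_sres r k (P Q : 'M[R]_(r, n)) v (X : 'M[R]_(k, n)) :
  sres P Q v *m J *m X^T = v *m J *m X^T
    - v *m J *m Q^T *m (P *m J *m X^T) + v *m J *m P^T *m (Q *m J *m X^T).
Proof. by rewrite /sres !(mulmxDl, mulNmx) !mulmxA. Qed.

Lemma sres_orthl r (P Q : 'M[R]_(r, n)) v : sympl P Q -> sres P Q v *m J *m P^T = 0.
Proof.
move=> sPQ; rewrite mul_sres (sympl_QP sPQ); case: sPQ => _ -> _.
by rewrite mulmx0 subr0 mulmxN mulmx1 subrr.
Qed.

Lemma sres_orthr r (P Q : 'M[R]_(r, n)) v : sympl P Q -> sres P Q v *m J *m Q^T = 0.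
Proof.
by move=> sPQ; rewrite mul_sres; case: sPQ => -> _ ->; rewrite mulmx1 subrr add0r mulmx0.
Qed.

Lemma om_sres r (P Q : 'M[R]_(r, n)) v w : sympl P Q ->
  sform J (sres P Q v) (sres P Q w) = sform J (sres P Q v) w.
Proof.
move=> sPQ; rewrite om_skew // [in RHS]om_skew // /sform mul_sres.
rewrite [P *m J *m _]sform_skew [Q *m J *m _]sform_skew sres_orthl // sres_orthr //.
by rewrite trmx0 oppr0 !mulmx0 subr0 addr0.
Qed.

Lemma sympl_extend r (P Q : 'M[R]_(r, n)) s t : sympl P Q -> sform J s t = 1 ->
  s *m J *m P^T = 0 -> s *m J *m Q^T = 0 -> t *m J *m P^T = 0 -> t *m J *m Q^T = 0 ->
  sympl (col_mx P s) (col_mx Q t).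
Proof.
move=> [PQ PP QQ] st sP sQ tP tQ.
have st1 : s *m J *m t^T = 1%:M by rewrite [LHS]mx11_scalar -/(sform J s t) st.
have ss : s *m J *m s^T = 0 by rewrite [LHS]mx11_scalar -/(sform J s s) omxx // raddf0.
have tt : t *m J *m t^T = 0 by rewrite [LHS]mx11_scalar -/(sform J t t) omxx // raddf0.
by split; rewrite mul_col_mx tr_col_mx mul_col_row ?PQ ?PP ?QQ ?sP ?sQ ?tQ ?st1 ?ss ?tt
  1?sform_skew ?sP ?tP ?tQ trmx0 oppr0 ?block_mx0 -?scalar_mx_block.
Qed.

Lemma sres_extend r (P Q : 'M[R]_(r, n)) s t v : s *m J *m P^T = 0 -> s *m J *m Q^T = 0 ->
  t *m J *m P^T = 0 -> t *m J *m Q^T = 0 ->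
  sres (col_mx P s) (col_mx Q t) v =
  sres P Q v - sform J (sres P Q v) t *: s + sform J (sres P Q v) s *: t.
Proof.
move=> sP sQ tP tQ.
have -> : sform J (sres P Q v) t = sform J v t.
  rewrite /sform mul_sres [P *m J *m _]sform_skew [Q *m J *m _]sform_skew tP tQ.
  by rewrite trmx0 oppr0 !mulmx0 subr0 addr0.
have -> : sform J (sres P Q v) s = sform J v s.
  rewrite /sform mul_sres [P *m J *m _]sform_skew [Q *m J *m _]sform_skew sP sQ.
  by rewrite trmx0 oppr0 !mulmx0 subr0 addr0.
rewrite /sres !tr_col_mx !mul_mx_row !mul_row_col !mul11mx -/(sform J v t) -/(sform J v s).
by apply/rowP => j; rewrite !mxE; ring.
Qed.

Lemma sympl_le r (P Q : 'M[R]_(r, n)) : sympl P Q -> (r <= n)%N.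
Proof.
case=> PQ _ _; rewrite -[r](mxrank1 R) -PQ -mulmxA.
exact: leq_trans (mxrankM_maxl _ _) (rank_leq_col _).
Qed.

(** [S] is not assumed to be a subspace, so the membership of the residuals is carried along in
    [inv] and renewed by [S_project]. A frame grows as long as two residuals pair nontrivially;
    [sympl_le] stops this by step [n.+1]. *)
Lemma symplectic_gram_schmidt (I : finType) (y : I -> 'rV[R]_n) : (forall i, S (y i)) ->
  exists r (P Q : 'M[R]_(r, n)), [/\ sympl P Q, forall i, S (row i P), forall i, S (row i Q)
    & forall i j, sform J (sres P Q (y i)) (y j) = 0].
Proof.
move=> Sy; pose inv r := exists P Q : 'M[R]_(r, n),
  [/\ sympl P Q, forall i, S (row i P), forall i, S (row i Q) & forall i, S (sres P Q (y i))].
pose maximal r := exists P Q : 'M[R]_(r, n), [/\ sympl P Q, forall i, S (row i P),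
  forall i, S (row i Q) & forall i j, sform J (sres P Q (y i)) (y j) = 0].
suff step k : (exists r, maximal r) \/ exists2 r, (k <= r)%N & inv r.
  case: (step n.+1) => // -[r nr [P [Q [/sympl_le rn _ _ _]]]].
  by have := leq_trans nr rn; rewrite ltnn.
elim: k => [|k [|[r kr [P [Q [sPQ SP SQ Sr]]]]]]; try by left.
  right; exists 0%N => //; exists 0, 0; split; try by case.
    by split; apply/matrixP => -[].
  by move=> i; rewrite /sres !mulmx0 subr0 addr0.
have [/forallP done_|] := boolP [forall i, forall j, sform J (sres P Q (y i)) (y j) == 0].
  by left; exists r, P, Q; split=> // i j; apply/eqP; have /forallP := done_ i; apply.
rewrite negb_forall => /existsP[i1]; rewrite negb_forall => /existsP[j1 ij0].
right; exists (r + 1)%N; first by rewrite addn1.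
pose s := sres P Q (y i1); pose t := (sform J s (y j1))^-1 *: sres P Q (y j1).
have Ss : S s by exact: Sr.
have St : S t by apply: S_scale; exact: Sr.
have st : sform J s t = 1 by rewrite /t omZr // om_sres // mulVf.
have [sP sQ] : s *m J *m P^T = 0 /\ s *m J *m Q^T = 0 by rewrite sres_orthl // sres_orthr.
have [tP tQ] : t *m J *m P^T = 0 /\ t *m J *m Q^T = 0.
  by rewrite /t -!scalemxAl sres_orthl // sres_orthr // !scaler0.
exists (col_mx P s), (col_mx Q t); split; first exact: sympl_extend.
- by move=> l; case: (split_ordP l) => l' ->; rewrite ?rowKu ?rowKd // row_id //.
- by move=> l; case: (split_ordP l) => l' ->; rewrite ?rowKu ?rowKd // row_id //.
by move=> l; rewrite sres_extend //; apply: S_project.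
Qed.

End SymplecticGramSchmidt.

(** * Strong pinching from transvections *)

Section Core.
Variables (R : archiRealFieldType) (n : nat) (J : 'M[R]_n) (NN : 'M[R]_n -> Prop).
Hypothesis J_skew : J^T = - J.
Hypothesis NN_mul : forall P Q, NN P -> NN Q -> NN (P *m Q).
Variables (A : finType) (h : A -> 'rV[R]_n) (la lz : A).
Let a := h la.
Let z := h lz.
Hypothesis om_az : sform J a z = -1.
Hypotheses (NNz : NN (transvec J z 1)) (NNa : NN (transvec J a (-1))).
Hypothesis letterP : forall b, b != la -> b != lz ->
  [/\ sform J a (h b) = -1, sform J z (h b) = 1,
      NN (transvec J (h b) (-1) *m transvec J z 1) & NN (transvec J (h b) 1 *m transvec J a (-1))].
Hypothesis h_span : forall x, (forall b, sform J x (h b) = 0) -> x = 0.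

Let eJ := omE J_skew.
Let om_za : sform J z a = 1. Proof. by rewrite om_skew // om_az opprK. Qed.
Let K0 := nrm (J *m z^T) + nrm (J *m a^T).
Let pr := a - z.

Let S := ctv_att J NN a z.

Let a_p0 : a *m plproj J a z = 0.
Proof. by rewrite mul_plproj !eJ om_az; apply/rowP => j; rewrite !mxE; ring. Qed.

Let z_p0 : z *m plproj J a z = 0.
Proof. by rewrite mul_plproj !eJ om_za; apply/rowP => j; rewrite !mxE; ring. Qed.

Let S_letter b : S (h b *m plproj J a z).
Proof.
have S0 : S 0.
  split=> [|m]; first by rewrite mul0mx.
  by rewrite /ctransvec mulmx0 scaler0 addr0; apply: att_plproj.
have [->|bla] := eqVneq b la; first by rewrite a_p0.
have [->|blz] := eqVneq b lz; first by rewrite z_p0.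
by have [? ? ? ?] := letterP bla blz; apply: ctv_att_letter.
Qed.

Let p0_J : plproj J a z *m J = J *m (plproj J a z)^T.
Proof.
have -> : (plproj J a z)^T = 1%:M - a^T *m z *m J + z^T *m a *m J.
  rewrite /plproj raddfB /= raddfD /= trmx1 !trmx_mul !trmxK J_skew.
  by rewrite !mulmxN !mulmxA opprK.
rewrite mulmxBl mulmxDl mul1mx mulmxDr mulmxBr mulmx1 !mulmxA.
by rewrite addrAC.
Qed.

(** The residuals of the projected letters pair to 0 with all letters, hence vanish by
    nondegeneracy. Thus the identity is the sum of the projections onto the plane and onto the span
    of the frame, and its trace yields [n = 2 + 2 r]. *)
Lemma compressed_frame : exists r (P Q : 'M[R]_(r, n)),
  [/\ n = r.+1.*2, sympl J P Q, P *m plproj J a z = P, Q *m plproj J a z = Q &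
      forall i, S (row i P)].
Proof.
have S_scale c v : S v -> S (c *: v) by exact: ctv_att_scale.
have S_conj v w m : S v -> S w -> S (v + (m * sform J v w) *: w) by exact: ctv_att_conj.
have S_lim v w : (forall e : R, 0 < e -> S (v + e *: w)) -> S v by exact: ctv_att_lim.
have [r [P [Q [sPQ SP SQ PQ0]]]] := symplectic_gram_schmidt J_skew S_scale S_conj S_lim S_letter.
have Pp : P *m plproj J a z = P by apply/row_matrixP => i; rewrite row_mul; case: (SP i).
have Qp : Q *m plproj J a z = Q by apply/row_matrixP => i; rewrite row_mul; case: (SQ i).
exists r, P, Q; split=> //.
have mulp : forall x, x *m plproj J a z = x + sform J x z *: a - sform J x a *: z.
  by move=> x; rewrite mul_plproj.
move: (plproj J a z) mulp Pp Qp PQ0 => p mulp Pp Qp PQ0.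
have sres_p v : sres J P Q (v *m p) *m p = sres J P Q (v *m p).
  rewrite /sres mulmxDl mulmxBl -[_ *m P *m p]mulmxA Pp -[_ *m Q *m p]mulmxA Qp.
  congr (_ - _ + _); rewrite mulp !mulp !eJ om_az om_za.
  by apply/rowP => j; rewrite !mxE; ring.
have om_pa x : sform J (x *m p) a = 0 by rewrite mulp !eJ om_za; ring.
have om_pz x : sform J (x *m p) z = 0 by rewrite mulp !eJ om_az; ring.
have om_p x v : sform J (x *m p) v = sform J (x *m p) (v *m p).
  by rewrite [v *m p]mulp !eJ om_pa om_pz !mulr0 subr0 addr0.
have sres_letter i : sres J P Q (h i *m p) = 0.
  by apply: h_span => b; rewrite -sres_p om_p sres_p PQ0.
have om_sres0 x (c : 'rV_r) (X : 'M_(r, n)) : x *m J *m X^T = 0 -> sform J x (c *m X) = 0.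
  by move=> xX; rewrite /sform trmx_mul mulmxA xX mul0mx mxE.
have sres0 x : sres J P Q (x *m p) = 0.
  apply: h_span => b; rewrite -sres_p om_p sres_p.
  have := sres_letter b; rewrite /sres => /eqP; rewrite addr_eq0 subr_eq => /eqP ->.
  rewrite (omDr J_skew) (omNr J_skew).
  rewrite !om_sres0 ?sres_orthr ?sres_orthl //.
  by rewrite oppr0 add0r.
have decomposition : 1%:M = J *m a^T *m z - J *m z^T *m a
    + (p *m J *m Q^T *m P - p *m J *m P^T *m Q).
  apply: row_ext => x; rewrite mulmx1 !(mulmxDr, mulmxN) !mul_rank1 !mulmxA.
  have := sres0 x; rewrite /sres => /eqP; rewrite addr_eq0 subr_eq addrC => /eqP <-.
  by rewrite mulp; apply/rowP => j; rewrite !mxE; ring.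
have : (n%:R : R) = r.+1.*2%:R.
  rewrite -mxtrace1 decomposition !(mxtraceD, raddfN) /=.
  rewrite ![\tr (J *m _ *m _)]mxtrace_mulC ![\tr (p *m _ *m _ *m _)]mxtrace_mulC !mulmxA.
  rewrite Pp Qp (sympl_QP J_skew sPQ); case: sPQ => -> _ _.
  rewrite !trace_mx11 -/(sform J z a) -/(sform J a z) om_az om_za mxtrace1.
  have -> : \tr (- 1%:M : 'M[R]_r) = - r%:R by rewrite raddfN /= mxtrace1.
  by rewrite doubleS -addnn -addn2 !natrD; ring.
by move/eqP; rewrite eqr_nat => /eqP.
Qed.


(** As the rows of [P] are pairwise orthogonal, the compressed transvections along them multiply by
    adding their exponents. The constant remains [K0] for all [w]. *)
Lemma att_frame r (P : 'M[R]_(r, n)) (w : 'rV[R]_r) :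
  P *m J *m P^T = 0 -> P *m plproj J a z = P -> (forall i, S (row i P)) ->
  attained NN pr K0 (plproj J a z + J *m P^T *m diag_mx w *m P).
Proof.
move=> PP Pp SP; pose G (u : 'rV[R]_r) := plproj J a z + J *m P^T *m diag_mx u *m P.
have K00 : 0 <= K0 by rewrite addr_ge0 ?nrm_ge0.
have pPT : plproj J a z *m (J *m P^T) = J *m P^T.
  by rewrite mulmxA p0_J -mulmxA -trmx_mul Pp.
have pp : plproj J a z *m plproj J a z = plproj J a z.
  apply: row_ext => x; rewrite mulmxA !mul_plproj !eJ om_az om_za.
  by apply/rowP => j; rewrite !mxE; ring.
have GD u u' : G u *m G u' = G (u + u').
  rewrite /G; move: (plproj J a z) pPT pp Pp => p pPT pp Pp.
  rewrite mulmxDl !mulmxDr pp -addrA; congr (_ + _).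
  rewrite !mulmxA -[p *m J *m _]mulmxA pPT -[_ *m P *m p]mulmxA Pp.
  rewrite -[_ *m P *m J]mulmxA -[_ *m (P *m J) *m _]mulmxA PP mulmx0 !mul0mx addr0.
  by rewrite linearD /= mulmxDr mulmxDl addrC.
rewrite -/(G w) (row_sum_delta w); elim/big_ind: _ => [|u u' au au'|i _].
- by rewrite /G linear0 mulmx0 mul0mx addr0; apply: att_plproj.
- by rewrite -GD; apply: (att_mul NN_mul K00 au au').
case: (SP i) => _ /(_ (w 0 i)); congr (attained _ _ _ (_ + _)).
rewrite linearZ /= -scalemxAr -scalemxAl; congr (_ *: _).
have -> : diag_mx (delta_mx 0 i) = (delta_mx i 0 : 'cV[R]_r) *m (delta_mx 0 i : 'rV[R]_r).
  rewrite mul_delta_mx; apply/matrixP => k l; rewrite !mxE eqxx /=.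
  case: (k =P i) => [->|_]; case: (l =P i) => [li|li]; rewrite /= ?mul0rn //; first by rewrite li eqxx.
  by case: eqP => // il; case: li.
by rewrite (mulmxA _ (delta_mx i 0)) -(mulmxA _ (delta_mx 0 i)) -rowE -[_ *m delta_mx _ _]mulmxA -colE -tr_row.
Qed.

(* [E'] and [F'] below invert [E] on the left and [F] on the right by a triangular elimination. *)
Lemma dominated_core : exists r, n = r.+1.*2 /\ exists K : R,
  forall (w : 'rV[R]_r) (L : R), exists N l (E F' : 'M[R]_(n, 1 + r)) (F E' : 'M[R]_(1 + r, n)) B,
  [/\ NN N, L <= l, N = E *m diag_mx (row_mx l%:M w) *m F + B, E' *m E = 1%:M /\ F *m F' = 1%:M
    & [/\ nrm E <= K, nrm F <= K, nrm E' <= K, nrm F' <= K & nrm B <= K]].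
Proof.
have [r [P [Q [nr sPQ Pp Qp SP]]]] := compressed_frame; exists r; split=> //.
(* [q] is dual to [pr] inside the plane: [pr q = 1] and [P q = 0]. It almost inverts the row [c],
   which is close to [pr]. *)
pose q := - (2^-1 *: (J *m z^T + J *m a^T)).
have JpT (X : 'M_(r, n)) v : X *m plproj J a z = X -> v *m plproj J a z = 0 -> X *m J *m v^T = 0.
  by move=> Xp vp; rewrite -Xp -[X *m _ *m J]mulmxA p0_J -!mulmxA -trmx_mul vp trmx0 !mulmx0.
have vJT (X : 'M_(r, n)) v : X *m plproj J a z = X -> v *m plproj J a z = 0 -> v *m J *m X^T = 0.
  by move=> Xp vp; rewrite sform_skew // JpT // trmx0 oppr0.
have pr_p : pr *m plproj J a z = 0 by rewrite mulmxBl a_p0 z_p0 subr0.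
have prq : pr *m q = 1%:M.
  rewrite mulmxN -scalemxAr mulmxDr !mulmxA [pr *m J *m z^T]mx11_scalar [pr *m J *m a^T]mx11_scalar.
  rewrite -/(sform J pr z) -/(sform J pr a) /pr !eJ om_az om_za.
  by apply/matrixP => i j; rewrite !ord1 !mxE !eqxx !mulr1n; field.
have Pq : P *m q = 0.
  by rewrite mulmxN -scalemxAr mulmxDr !mulmxA !JpT ?z_p0 ?a_p0 // addr0 scaler0 oppr0.
have QP := sympl_QP J_skew sPQ; case: sPQ => PQ PP QQ.
pose M1 := nrm pr; pose M2 := nrm q; pose M3 := K0 + 1; pose M4 := M1 + 1.
pose K1 := M3 + nrm (J *m P^T); pose K2 := M4 + nrm P.
pose K3 := 2 * M1 + (nrm Q + 2 * (nrm Q * M3 * M1)).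
pose K4 := 2 * M2 + (nrm (J *m Q^T) + 2 * (M2 * (M4 * nrm (J *m Q^T)))).
pose K5 := nrm (plproj J a z) + 1.
have K00 : 0 <= K0 by rewrite addr_ge0 ?nrm_ge0.
have M10 : 0 <= M1 := nrm_ge0 _; have M20 : 0 <= M2 := nrm_ge0 _.
have M30 : 0 <= M3 by rewrite addr_ge0.
have M40 : 0 <= M4 by rewrite addr_ge0.
have K10 : 0 <= K1 by rewrite addr_ge0 ?nrm_ge0.
have K20 : 0 <= K2 by rewrite addr_ge0 ?nrm_ge0.
have K30 : 0 <= K3 by rewrite !addr_ge0 ?mulr_ge0 ?nrm_ge0.
have K40 : 0 <= K4 by rewrite !addr_ge0 ?mulr_ge0 ?nrm_ge0.
have K50 : 0 <= K5 by rewrite addr_ge0 ?nrm_ge0.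
exists (K1 + K2 + K3 + K4 + K5) => w L.
have [_ aG] := att_frame w PP Pp SP.
(* This precision ensures [L <= l] and keeps both [pr b] and [c q] above [1/2]. *)
pose d := (2 * (M2 + 1) + `|L|)^-1.
have d1 : 0 < 2 * (M2 + 1) + `|L| by rewrite ltr_wpDr // mulr_gt0 // ltr_wpDl.
have d0 : 0 < d by rewrite invr_gt0.
have d12 : d <= 1 / 2.
  rewrite -[1 / 2]invrK lef_pV2 ?posrE ?invr_gt0 ?divr_gt0 // invf_div divr1.
  by have := normr_ge0 L; lra.
have dM2 : d * M2 <= 1 / 2.
  by rewrite ler_pdivrMl //; have := normr_ge0 L; lra.
have [N [l [b [c [S' [NN_N NE dl [nb prb nc nS]]]]]]] := aG d d0.
pose be := (pr *m b) 0 0; pose ga := (c *m q) 0 0.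
have be12 : 1 / 2 <= be by move: prb; rewrite -/be ler_norml => /andP[]; lra.
have ga12 : 1 / 2 <= ga.
  have : `|ga - 1| <= d * M2.
    have -> : ga - 1 = ((c - pr) *m q) 0 0 by rewrite mulmxBl prq /ga !mxE eqxx.
    by rewrite -nrm11; apply: nrmM_le.
  by rewrite ler_norml => /andP[]; lra.
have inv2 (x : R) : 1 / 2 <= x -> `|x^-1| <= 2.
  move=> x12; have x0 : 0 < x by lra.
  by rewrite gtr0_norm ?invr_gt0 // -[2]invrK lef_pV2 ?posrE ?invr_gt0 //; lra.
have be0 : be != 0 by rewrite gt_eqF //; lra.
have ga0 : ga != 0 by rewrite gt_eqF //; lra.
have nb' : nrm b <= M3 by rewrite /M3; lra.
have nc' : nrm c <= M4.
  by have := nrmD_le nc (lexx (nrm pr)); rewrite subrK /M4 /M1; lra.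
(* The weighted block [J P^T diag(w) P] joins [l b c] in [E D F], so that [B] is the projection up
   to an error at most [d], whatever [w]. *)
exists N, l, (row_mx b (J *m P^T)), (row_mx (ga^-1 *: q) (J *m Q^T - ga^-1 *: (q *m (c *m (J *m Q^T))))),
  (col_mx c P), (col_mx (be^-1 *: pr) (- Q + be^-1 *: (Q *m b *m pr))),
  (plproj J a z + (S' - (plproj J a z + J *m P^T *m diag_mx w *m P))).
split=> //.
- by apply: le_trans dl; rewrite invrK; have := ler_norm L; lra.
- rewrite NE diag_mx_row mul_row_block !mulmx0 addr0 add0r mul_row_col.
  rewrite [diag_mx _](_ : _ = l%:M); last first.
    by apply/matrixP => i j; rewrite !ord1 !mxE.
  rewrite mul_mx_scalar -scalemxAl.
  by apply/matrixP => i j; rewrite !mxE; ring.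
- have prb1 : pr *m b = be%:M by rewrite [LHS]mx11_scalar.
  have prJP : pr *m (J *m P^T) = 0 by rewrite mulmxA vJT.
  have cq : c *m q = ga%:M by rewrite [LHS]mx11_scalar.
  split.
    rewrite mul_col_row -2![(be^-1 *: pr) *m _]scalemxAl prb1 prJP.
    rewrite 2!mulmxDl 2!mulNmx -2!scalemxAl -2![Q *m b *m pr *m _]mulmxA prb1 prJP mulmxA QP.
    rewrite mul_mx_scalar !mulmx0 !scaler0 addr0 opprK scalerA mulVf // scale1r addNr.
    by rewrite scale_scalar_mx mulVf // -scalar_mx_block.
  rewrite mul_col_row 2!mulmxBr -2![_ *m (ga^-1 *: q)]scalemxAr.
  rewrite -[c *m (ga^-1 *: _)]scalemxAr -[P *m (ga^-1 *: _)]scalemxAr.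
  rewrite (mulmxA c q) (mulmxA P q) cq Pq mul0mx !scaler0 subr0.
  rewrite mul_scalar_mx scalerA mulVf // scale1r subrr.
  by rewrite scale_scalar_mx mulVf // mulmxA PQ -scalar_mx_block.
have nQ : nrm Q <= nrm Q by [].
have KE : K1 <= K1 + K2 + K3 + K4 + K5 by lra.
have KF : K2 <= K1 + K2 + K3 + K4 + K5 by lra.
have KE' : K3 <= K1 + K2 + K3 + K4 + K5 by lra.
have KF' : K4 <= K1 + K2 + K3 + K4 + K5 by lra.
have KB : K5 <= K1 + K2 + K3 + K4 + K5 by lra.
split.
- by apply: le_trans KE; rewrite nrm_row_mx lerD2r.
- by apply: le_trans KF; rewrite nrm_col_mx lerD2r.
- apply: le_trans KE'; rewrite nrm_col_mx; apply: lerD.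
    by rewrite nrmZ ler_wpM2r ?inv2.
  apply: nrmD_le; first by rewrite nrmN.
  rewrite nrmZ; apply: ler_pM; rewrite ?nrm_ge0 ?inv2 //.
  by apply: nrmM_le => //; apply: nrmM_le.
- apply: le_trans KF'; rewrite nrm_row_mx; apply: lerD.
    by rewrite nrmZ ler_wpM2r ?inv2.
  apply: nrmD_le => //; rewrite nrmN nrmZ; apply: ler_pM; rewrite ?nrm_ge0 ?inv2 //.
  by apply: nrmM_le => //; apply: nrmM_le.
apply: le_trans KB; apply: nrmD_le => //; apply: le_trans nS _; lra.
Qed.

End Core.

(** * Rauzy paths between standard permutations *)

(* Simplification identifies the different elaborations of [#|A|], which [lia] distinguishes. *)
Ltac card_lia := simpl in *; lia.

Section Combinatorics.
Variable A : finType.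
Local Notation d := #|A|.
Implicit Types (p q : perm_pair A) (x y z : A).

Lemma position_surj (f : A -> nat) k : injective f -> (forall a, (f a < d)%N) -> (k < d)%N ->
  exists a, f a = k.
Proof.
move=> f_inj f_lt kd; pose F a : 'I_d := Ordinal (f_lt a).
have F_inj : injective F by move=> x y /(congr1 val) /f_inj.
have [G _ FG] : bijective F by apply: inj_card_bij; rewrite ?card_ord.
by exists (G (Ordinal kd)); have := congr1 val (FG (Ordinal kd)).
Qed.

Lemma card_positions (f : A -> nat) k : injective f -> (forall a, (f a < d)%N) -> (k <= d)%N ->
  #|[set a | (f a < k)%N]| = k.
Proof.
move=> f_inj f_lt; elim: k => [_|k IH kd].
  by apply: eq_card0 => a; rewrite inE.
have [y fy] := position_surj f_inj f_lt kd.
have -> : [set a | (f a < k.+1)%N] = y |: [set a | (f a < k)%N].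
  apply/setP => a; rewrite !inE ltnS leq_eqVlt -fy; congr (_ || _).
  by rewrite (inj_eq f_inj).
by rewrite cardsU1 inE fy ltnn /= IH // ltnW.
Qed.

Definition swap_rows p : perm_pair A := (p.2, p.1).

(** Exchanging the rows exchanges the two operations with the same winner and loser, so that it is
    enough to study top operations. *)
Lemma rauzy_step_swap b p :
  rauzy_step (~~ b) (swap_rows p) = omap (fun r => (swap_rows r.1, r.2)) (rauzy_step b p).
Proof.
rewrite /rauzy_step /last_top /last_bot /=.
by case: b => /=; case: pickP => [? _|_]; case: pickP.
Qed.

Lemma irreducible_swap p : irreducible p -> irreducible (swap_rows p).
Proof. by case=> -[? ? ? ? ?] irr; split=> // k k0 kd; rewrite eq_sym; apply: irr. Qed.

Lemma swap_rowsK p : swap_rows (swap_rows p) = p.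
Proof. by case: p. Qed.

Lemma last_topE p x : valid_perm p -> p.1 x = d.-1 -> last_top p = Some x.
Proof.
case=> _ _ _ inj1 _ px; rewrite /last_top; case: pickP => [z /eqP zd|/(_ x)]; last by rewrite px eqxx.
by congr Some; apply: inj1; rewrite px.
Qed.

Lemma last_botE p y : valid_perm p -> p.2 y = d.-1 -> last_bot p = Some y.
Proof.
case=> _ _ _ _ inj2 py; rewrite /last_bot; case: pickP => [z /eqP zd|/(_ y)]; last by rewrite py eqxx.
by congr Some; apply: inj2; rewrite py.
Qed.

Definition top_move p x y : perm_pair A :=
  (p.1, [ffun z => if z == y then (p.2 x).+1
                   else if (p.2 x < p.2 z)%N then (p.2 z).+1 else p.2 z]).

Lemma rauzy_step_top p x y : valid_perm p -> p.1 x = d.-1 -> p.2 y = d.-1 ->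
  rauzy_step true p = Some (top_move p x y, (x, y)).
Proof. by move=> vp px py; rewrite /rauzy_step (last_topE vp px) (last_botE vp py). Qed.

Lemma rauzy_step_topP p r : irreducible p -> rauzy_step true p = Some r ->
  exists x y, [/\ p.1 x = d.-1, p.2 y = d.-1, (p.2 x < d.-1)%N & r = (top_move p x y, (x, y))].
Proof.
move=> [vp irr]; case: (vp) => d2 lt1 lt2 inj1 inj2.
have dd : (d.-1 < d)%N by rewrite prednK // ltnW.
have [x px] := position_surj inj1 lt1 dd; have [y py] := position_surj inj2 lt2 dd.
rewrite (rauzy_step_top vp px py) => -[<-]; exists x, y; split=> //.
rewrite ltn_neqAle -ltnS prednK ?lt2 ?andbT; last exact: ltnW.
(* A letter that is last in both rows would leave the same letters in the first [d.-1] positions. *)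
apply/eqP => p2x; have := irr d.-1; rewrite dd -ltnS prednK ?d2; last exact: ltnW.
move=> /(_ isT isT) /eqP; apply; apply/setP => a; rewrite !inE.
have [->|ax] := eqVneq a x; first by rewrite px p2x.
have a1 : p.1 a <> d.-1 by rewrite -px => /inj1 /eqP; rewrite (negPf ax).
have a2 : p.2 a <> d.-1 by rewrite -p2x => /inj2 /eqP; rewrite (negPf ax).
by have := lt1 a; have := lt2 a; card_lia.
Qed.

Lemma top_move_irreducible p x y : irreducible p -> p.1 x = d.-1 -> p.2 y = d.-1 ->
  (p.2 x < d.-1)%N -> irreducible (top_move p x y).
Proof.
move=> [[d2 lt1 lt2 inj1 inj2] irr] px py xy.
split; first split=> //=.
- move=> z; rewrite ffunE; have [_|zy] /= := eqVneq z y; first by card_lia.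
  have : p.2 z <> d.-1 by rewrite -py => /inj2 /eqP; rewrite (negPf zy).
  by have := lt2 z; case: ifP; card_lia.
- move=> z t; rewrite !ffunE.
  have [->|zy] /= := eqVneq z y; have [->|ty] /= := eqVneq t y => //.
  + by case: ifP; card_lia.
  + by case: ifP; card_lia.
  by move=> zt; apply: inj2; move: zt; do 2!case: ifP; card_lia.
move=> k k0 kd; apply: contraNneq (irr k k0 kd) => /= eq_k; apply/eqP/setP => z.
have /setP eqk := eq_k; have := eqk z; rewrite !inE => ->; rewrite ffunE.
have xyF : (x == y) = false by apply/eqP => xy'; move: xy; rewrite xy' py ltnn.
(* [x] is last at the top, hence not among the [k] first letters; the move thus happens beyond
   position [k] and leaves the [k] first bottom letters in place. *)
have xk : (k <= p.2 x)%N.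
  by have := eqk x; rewrite !inE px ffunE xyF ltnn; card_lia.
have [->|zy] /= := eqVneq z y; first by rewrite py; card_lia.
by case: ifP; card_lia.
Qed.

Lemma rauzy_step_irreducible b p r : irreducible p -> rauzy_step b p = Some r -> irreducible r.1.
Proof.
wlog: b p r / b = true.
  case: b => [/(_ _ _ _ erefl)|H irr step]; first exact.
  have := H true (swap_rows p) (swap_rows r.1, r.2) erefl (irreducible_swap irr).
  rewrite -[true]/(~~ false) rauzy_step_swap step => /(_ erefl) /irreducible_swap.
  by rewrite swap_rowsK.
move=> -> irr step; have [x [y [px py xy ->]]] := rauzy_step_topP irr step.
exact: top_move_irreducible.
Qed.

End Combinatorics.

Section RauzyPaths.
Variables (A : finType) (R : realType).
Local Notation d := #|A|.
Implicit Types (p q : perm_pair A) (x y z : A) (M T : 'M[R]_d).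

Lemma run_path_mul p s T :
  run_path p s T = omap (fun r => (r.1, r.2 *m T)) (run_path p s 1%:M).
Proof.
elim: s p T => [|b s IH] p T /=; first by rewrite mul1mx.
case: rauzy_step => [[p' [w l]]|] //=; rewrite IH [in RHS]IH.
by case: run_path => //= -[q M]; rewrite mulmx1 mulmxA.
Qed.

Lemma run_path_cat p s t T :
  run_path p (s ++ t) T = obind (fun r => run_path r.1 t r.2) (run_path p s T).
Proof. by elim: s p T => //= b s IH p T; case: rauzy_step => [[p' [w l]]|]. Qed.

Definition rpath p q M := exists s, run_path p s 1%:M = Some (q, M).

Lemma rpath_cat p q r M N : rpath p q M -> rpath q r N -> rpath p r (N *m M).
Proof.
by move=> [s ps] [t qt]; exists (s ++ t); rewrite run_path_cat ps /= run_path_mul qt.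
Qed.

Lemma rpath_swap p q M : rpath p q M -> rpath (swap_rows p) (swap_rows q) M.
Proof.
case=> s; elim: s p M => [|b s IH] p M.
  by case=> <- <-; exists [::].
rewrite /=; case E: rauzy_step => [[p' [w l]]|] //.
rewrite run_path_mul mulmx1; case E' : run_path => [[q' M']|] //= -[qq <-].
rewrite qq in E'; have [t tE] := IH _ _ E'; exists (~~ b :: t).
by rewrite /= rauzy_step_swap E /= run_path_mul tE mulmx1.
Qed.

Lemma rpath_ind (P : perm_pair A -> perm_pair A -> 'M[R]_d -> Prop) :
  (forall p, irreducible p -> P p p 1%:M) ->
  (forall p b p' w l q M, irreducible p -> rauzy_step b p = Some (p', (w, l)) -> irreducible p' ->
     P p' q M -> P p q (M *m theta_arrow R w l)) ->
  forall p q M, irreducible p -> rpath p q M -> P p q M.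
Proof.
move=> P0 PS p q M irr [s]; elim: s p M irr => [|b s IH] p M irr /=.
  by case=> <- <-; exact: P0.
case E: rauzy_step => [[p' [w l]]|] //; have irr' := rauzy_step_irreducible irr E.
rewrite run_path_mul mulmx1; case E' : run_path => [[q' M']|] //= -[qq <-].
by apply: (PS _ _ _ _ _ _ _ irr E irr'); apply: IH; rewrite // E' qq.
Qed.

Lemma rpath_irreducible p q M : irreducible p -> rpath p q M -> irreducible q.
Proof. by move: p q M; apply: rpath_ind. Qed.

Definition letter_col (f : A -> R) : 'cV[R]_d := \col_i f (enum_val i).
Definition letter_unit x : 'cV[R]_d := delta_mx (enum_rank x) 0.
(** For a path all of whose arrows have winner [x], this is [Theta] with [f b] the number of arrows
    with loser [b]. *)
Definition winner_mx (f : A -> R) x : 'M[R]_d := 1%:M + letter_col f *m (letter_unit x)^T.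

Lemma ev_lv x f : (letter_unit x)^T *m letter_col f = (f x)%:M.
Proof.
rewrite /letter_unit trmx_delta -rowE; apply/matrixP => i j.
by rewrite !ord1 !mxE eqxx enum_rankK.
Qed.

Lemma tm_fixes f x g : g x = 0 -> winner_mx f x *m letter_col g = letter_col g.
Proof.
by move=> gx; rewrite mulmxDl mul1mx -mulmxA ev_lv gx mul_mx_scalar scale0r addr0.
Qed.

Lemma mul_tm f g x : g x = 0 -> winner_mx f x *m winner_mx g x = winner_mx (fun z => f z + g z) x.
Proof.
move=> gx; rewrite [winner_mx g x]/winner_mx mulmxDr mulmx1 mulmxA tm_fixes // /winner_mx -addrA -mulmxDl.
by congr (_ + _ *m _); apply/matrixP => i j; rewrite !mxE.
Qed.

Lemma eq_tm f g x : f =1 g -> winner_mx f x = winner_mx g x.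
Proof. by move=> fg; congr (_ + _ *m _); apply/matrixP => i j; rewrite !mxE. Qed.

Lemma theta_arrowE w l : theta_arrow R w l = winner_mx (fun z => (z == l)%:R) w.
Proof.
rewrite /theta_arrow /winner_mx; congr (_ + _).
have -> : letter_col (fun z => (z == l)%:R) = delta_mx (enum_rank l) 0.
  by apply/matrixP => i j; rewrite !ord1 !mxE eqxx andbT -(inj_eq enum_rank_inj) enum_valK.
by rewrite /letter_unit trmx_delta mul_delta_mx.
Qed.

(** The effect of [k] top operations with winner [x]: the bottom letters after [x] turn cyclically
    among [d.-1 - p.2 x] places. The formula is meant for at most one full turn. *)
Definition rot_bottom p x k : perm_pair A :=
  (p.1, [ffun z => if (p.2 z <= p.2 x)%N then p.2 z
                   else if (p.2 z + k < d)%N then (p.2 z + k)%N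
                   else (p.2 z + k - (d.-1 - p.2 x))%N]).

Lemma rot_bottom0 p x : irreducible p -> rot_bottom p x 0 = p.
Proof.
move=> [[_ _ lt2 _ _] _]; case: p lt2 => p1 p2 /= lt2; congr pair.
by apply/ffunP => z; rewrite ffunE /= addn0 lt2 if_same.
Qed.

Lemma rot_bottom_full p x : irreducible p -> rot_bottom p x (d.-1 - p.2 x) = p.
Proof.
move=> [[d2 _ lt2 _ _] _]; case: p lt2 => p1 p2 /= lt2; congr pair.
apply/ffunP => z; rewrite ffunE /=; have := lt2 z; have := lt2 x.
by do 2?case: ifP; card_lia.
Qed.

(** At each step the last bottom letter loses and is put just after [x]; the losers are thus the [k]
    last bottom letters, once each. *)
Lemma run_top p x k : irreducible p -> p.1 x = d.-1 -> (k <= d.-1 - p.2 x)%N ->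
  run_path p (nseq k true) 1%:M = Some (rot_bottom p x k, winner_mx (fun z => (d - k <= p.2 z)%N%:R) x).
Proof.
move=> irr px; have [[d2 lt1 lt2 inj1 inj2] _] := irr; elim: k => [_|k IH kd].
  rewrite rot_bottom0 //=; congr (Some (_, _)).
  rewrite /winner_mx; have -> : letter_col (fun z => (d - 0 <= p.2 z)%N%:R) = 0; last by rewrite mul0mx addr0.
  by apply/matrixP => i j; rewrite !mxE subn0 leqNgt lt2.
rewrite -addn1 nseqD run_path_cat IH /=; last exact: ltnW.
have kd' : (d.-1 - k < d)%N by card_lia.
have [y py] := position_surj inj2 lt2 kd'.
have irr' : irreducible (rot_bottom p x k).
  apply: (rpath_irreducible irr); exists (nseq k true); apply: IH; exact: ltnW.
have py' : (rot_bottom p x k).2 y = d.-1.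
  by rewrite ffunE /= py; do 2?case: ifP; card_lia.
rewrite (@rauzy_step_top _ _ x y) //; last by case: irr'.
rewrite theta_arrowE mul_tm; last by rewrite leqNgt (_ : (_ < _)%N) //; card_lia.
congr (Some (_, _)).
  congr pair; apply/ffunP => z; rewrite /= !ffunE /= leqnn.
  have [->|zy] /= := eqVneq z y; first by rewrite py; do ?case: ifP; card_lia.
  have zy2 : p.2 z <> p.2 y by move/inj2/eqP; rewrite (negPf zy).
  by have := lt2 z; do ?case: ifP; card_lia.
apply: eq_tm => z; rewrite -natrD; congr (_%:R).
have [->|zy] /= := eqVneq z y; first by rewrite py; card_lia.
have zy2 : p.2 z <> p.2 y by move/inj2/eqP; rewrite (negPf zy).
by have := lt2 z; card_lia.
Qed.

End RauzyPaths.

Section StandardPermutations.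
Variables (A : finType) (R : realType).
Local Notation d := #|A|.
Implicit Types (p q : perm_pair A) (x y z : A) (M T : 'M[R]_d).

(** The rest of the full turn leads back to [p]. Paths are undone in this way, as arrows cannot be
    reversed. *)
Lemma run_top_return p x k : irreducible p -> p.1 x = d.-1 -> (k <= d.-1 - p.2 x)%N ->
  exists N : 'M[R]_d, rpath (rot_bottom p x k) p N /\
    N *m winner_mx (R := R) (fun z => (d - k <= p.2 z)%N%:R) x =
      winner_mx (R := R) (fun z => (p.2 x < p.2 z)%N%:R) x.
Proof.
move=> irr px kd; have [[d2 lt1 lt2 inj1 inj2] _] := irr.
have := run_top R irr px (leqnn _); rewrite -{1}(subnKC kd) nseqD run_path_cat.
rewrite (run_top R irr px kd) /= run_path_mul rot_bottom_full //.
case E : run_path => [[q N]|] //= -[qp NE]; exists N; split.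
  by exists (nseq (d.-1 - p.2 x - k) true); rewrite E qp.
rewrite NE; apply: eq_tm => z; congr (_%:R); have := lt2 x; have := lt2 z; card_lia.
Qed.

Definition connected p q := (exists M, @rpath A R p q M) /\ (exists M, @rpath A R q p M).

Lemma connected_trans p q r : connected p q -> connected q r -> connected p r.
Proof.
move=> [[M pq] [M' qp]] [[N qr] [N' rq]].
by split; [exists (N *m M) | exists (M' *m N')]; apply: rpath_cat; eassumption.
Qed.

Lemma connected_swap p q : connected p q -> connected (swap_rows p) (swap_rows q).
Proof. by move=> [[M pq] [M' qp]]; split; [exists M | exists M']; apply: rpath_swap. Qed.

Lemma connected_irreducible p q : irreducible p -> connected p q -> irreducible q.
Proof. by move=> irr [[M pq] _]; apply: rpath_irreducible pq. Qed.

Lemma connected_rot p x k : irreducible p -> p.1 x = d.-1 -> (k <= d.-1 - p.2 x)%N ->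
  connected p (rot_bottom p x k).
Proof.
move=> irr px kd; split; last by have [N []] := run_top_return irr px kd; exists N.
by exists (winner_mx (R := R) (fun z => (d - k <= p.2 z)%N%:R) x), (nseq k true); apply: run_top.
Qed.

Lemma connected_last_bottom p x y : irreducible p -> p.1 x = d.-1 -> (p.2 x < p.2 y)%N ->
  exists q, [/\ connected p q, q.1 = p.1, q.2 y = d.-1 &
    forall z, (p.2 z <= p.2 x)%N -> q.2 z = p.2 z].
Proof.
move=> irr px xy; have [[d2 lt1 lt2 inj1 inj2] _] := irr.
exists (rot_bottom p x (d.-1 - p.2 y)); split=> //.
- by apply: connected_rot => //; card_lia.
- by have := lt2 y; rewrite ffunE /=; do 2?case: ifP; card_lia.
by move=> z zx; rewrite ffunE zx.
Qed.

Lemma connected_last_top p x y : irreducible p -> p.2 x = d.-1 -> (p.1 x < p.1 y)%N ->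
  exists q, [/\ connected p q, q.2 = p.2 & q.1 y = d.-1].
Proof.
move=> /irreducible_swap irr px xy.
have [q [pq q1 q2 _]] := connected_last_bottom irr px xy.
exists (swap_rows q); split=> //; rewrite -[p]swap_rowsK; exact: connected_swap.
Qed.

Definition standard p a z := [/\ p.1 a = 0%N, p.2 a = d.-1, p.1 z = d.-1 & p.2 z = 0%N].

(* If the last top letter [x] is not first at the bottom, either the [p.2 x] first bottom letters
   are the first top ones, or some pair [y], [w] out of order lets a letter [w] with
   [p.2 w < p.2 x] become last at the top. *)
Lemma connected_standard p : irreducible p ->
  exists q a z, [/\ irreducible q, connected p q & standard q a z].
Proof.
move=> irr0; have [[d2 lt1 _ inj1 _] _] := irr0.
have dd : (d.-1 < d)%N by card_lia.
have [x0 px0] := position_surj inj1 lt1 dd.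
have [k] := ubnP (p.2 x0); elim: k p x0 irr0 px0 {d2 lt1 inj1 dd} => // k IH p x irr px xk.
have [[d2 lt1 lt2 inj1 inj2] irrk] := irr.
have [x0|x0] := eqVneq (p.2 x) 0%N.
  have d0 : (0 < d)%N by card_lia.
  have [a pa] := position_surj inj1 lt1 d0.
  have xa : (p.2 x < p.2 a)%N.
    rewrite x0 lt0n; apply: contraTneq d2 => a0; rewrite -leqNgt.
    have ax : a = x by apply: inj2; rewrite a0.
    by move: px; rewrite -ax pa; card_lia.
  have [q [pq q1 qa qx]] := connected_last_bottom irr px xa.
  exists q, a, x; split=> //; first exact: connected_irreducible pq.
  by split; rewrite ?q1 // qx ?x0.
have [/existsP [y /existsP [w /and3P [xy wx yw]]]|noex] :=
  boolP [exists y, exists w, [&& (p.2 x < p.2 y)%N, (p.2 w < p.2 x)%N & (p.1 y < p.1 w)%N]].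
  have [q [pq q1 qy qw]] := connected_last_bottom irr px xy.
  have irrq := connected_irreducible irr pq.
  have yw' : (q.1 y < q.1 w)%N by rewrite q1.
  have [r [qr r2 rw]] := connected_last_top irrq qy yw'.
  have irrr := connected_irreducible irrq qr.
  have [|s [a [z [irrs rs ss]]]] := IH r w irrr rw.
    by rewrite r2 qw ?(ltnW wx) //; apply: leq_trans wx _; rewrite -ltnS.
  by exists s, a, z; split=> //; apply: connected_trans pq (connected_trans qr rs).
have xd := lt2 x; have x0' : (0 < p.2 x)%N by rewrite lt0n.
have := irrk _ x0' xd; case/negP; rewrite eq_sym.
rewrite eqEcard !card_positions ?(ltnW xd) // leqnn andbT.
apply/subsetP => w; rewrite !inE => wx.
have below z : (p.1 z < p.1 w)%N -> (p.2 z < p.2 x)%N.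
  move=> zw; rewrite ltn_neqAle; apply/andP; split.
    by apply: contraTneq zw => /inj2 ->; rewrite px -leqNgt; have := lt1 w; card_lia.
  rewrite leqNgt; apply: contraNN noex => xz.
  by apply/existsP; exists z; apply/existsP; exists w; rewrite xz wx zw.
(* The top predecessors of [w] are fewer than [p.2 x], so [w] is among the [p.2 x] first top
   letters. *)
have sub : [set z | (p.1 z < p.1 w)%N] \proper [set z | (p.2 z < p.2 x)%N].
  apply/properP; split; first by apply/subsetP => z; rewrite !inE; apply: below.
  by exists w; rewrite !inE ?ltnn.
by have := proper_card sub; rewrite !card_positions // ltnW.
Qed.

Lemma standard_swap p a z : standard p a z -> standard (swap_rows p) z a.
Proof. by case. Qed.

Lemma standard_cycle p a z : irreducible p -> standard p a z ->
  rpath p p (winner_mx (R := R) (fun b => (p.2 z < p.2 b)%N%:R) z).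
Proof.
move=> irr [pa1 pa2 pz1 pz2]; exists (nseq (d.-1 - p.2 z) true).
rewrite (run_top R irr pz1 (leqnn _)) rot_bottom_full //; congr (Some (_, _)); apply: eq_tm => b.
by have [[d2 _ lt2 _ _] _] := irr; congr (_%:R); have := lt2 b; card_lia.
Qed.

(* A bottom cycle of winner [y] is inserted in the top cycle when [y] has become last. *)
Lemma standard_inserted_cycle p a z y : irreducible p -> standard p a z -> y != z ->
  rpath p p (winner_mx (R := R) (fun b => (p.2 z < p.2 b)%N%:R) z *m
    winner_mx (R := R) (fun b => (p.1 y < p.1 b)%N%:R - (p.2 y < p.2 b)%N%:R) y).
Proof.
move=> irr [pa1 pa2 pz1 pz2] yz; have [[d2 lt1 lt2 inj1 inj2] _] := irr.
pose k := (d.-1 - p.2 y)%N.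
have y0 : (0 < p.2 y)%N by rewrite lt0n -pz2 (inj_eq inj2).
have kd : (k <= d.-1 - p.2 z)%N by rewrite /k; card_lia.
have [N [retN NE]] := run_top_return irr pz1 kd.
have go := run_top R irr pz1 kd.
set q := rot_bottom p z k in go retN.
have irrq : irreducible q by apply: (rpath_irreducible irr); exists (nseq k true); exact: go.
have qy : q.2 y = d.-1.
  by have := lt2 y; rewrite ffunE /= /k; do 2?case: ifP; card_lia.
have cyc : rpath q q (winner_mx (R := R) (fun b => (p.1 y < p.1 b)%N%:R) y).
  rewrite -[q]swap_rowsK; apply: rpath_swap.
  exists (nseq (d.-1 - (swap_rows q).2 y) true).
  have irrs := irreducible_swap irrq.
  rewrite (@run_top _ R _ y _ irrs qy (leqnn _)) rot_bottom_full //.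
  congr (Some (_, _)); apply: eq_tm => b; congr (_%:R).
  by have := lt1 b; have := lt1 y; rewrite /= ; card_lia.
have := rpath_cat (ex_intro _ _ go) (rpath_cat cyc retN); congr rpath.
set f := (fun b => (d - k <= p.2 b)%N%:R) in NE *.
set t := (fun b => (p.1 y < p.1 b)%N%:R).
have fz : f z = 0 :> R by rewrite /f pz2 /k leqNgt (_ : (_ < _)%N) //; card_lia.
have fy : f y = 0 :> R.
  by rewrite /f /k leqNgt (_ : (_ < _)%N) //; have := lt2 y; card_lia.
pose g b : R := t b - (p.2 y < p.2 b)%N%:R.
have yz' : (p.1 y < p.1 z)%N.
  have : p.1 y <> p.1 z by move/inj1/eqP; rewrite (negPf yz).
  by have := lt1 y; card_lia.
have gz : g z = 1 by rewrite /g /t pz2 yz' ltn0 subr0.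
have fg b : f b + g b = t b.
  have -> : f b = (p.2 y < p.2 b)%N%:R.
    by congr (_%:R); have := lt2 y; rewrite /k; card_lia.
  by rewrite /g addrC subrK.
(* Performing the inserted cycle at [q] rather than at [p] conjugates it by [winner_mx f z], which
   sends the column of [g] to that of [t] because [g z = 1], and fixes the row of [y] because
   [f y = 0]. *)
rewrite -NE -!mulmxA; congr (_ *m _); rewrite -/t -/f.
have -> : winner_mx f z *m winner_mx g y = winner_mx f z + winner_mx f z *m letter_col g *m (letter_unit R y)^T.
  by rewrite [winner_mx g y]/winner_mx mulmxDr mulmx1 mulmxA.
have -> : winner_mx f z *m letter_col g = letter_col t.
  rewrite mulmxDl mul1mx -mulmxA ev_lv gz mulmx1.
  by apply/matrixP => i j; rewrite !mxE addrC fg.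
have -> : winner_mx t y *m winner_mx f z = winner_mx f z + letter_col t *m ((letter_unit R y)^T *m winner_mx f z).
  by rewrite [winner_mx t y]/winner_mx mulmxDl mul1mx mulmxA.
by rewrite [in (letter_unit R y)^T *m _]/winner_mx mulmxDr mulmx1 mulmxA ev_lv fy mul_scalar_mx scale0r addr0.
Qed.

End StandardPermutations.

(** * Action on H *)

Section OmegaTransport.
Variables (A : finType) (R : realType).
Local Notation d := #|A|.
Implicit Types (p q : perm_pair A) (x y z : A) (M T : 'M[R]_d).

Lemma omega_val_swap p x y : omega_val R (swap_rows p) x y = - omega_val R p x y.
Proof.
rewrite /omega_val /=.
by do ?[case: ifP => ?]; rewrite ?opprK ?oppr0 //; exfalso; lia.
Qed.

Lemma OmegaT_swap p : OmegaT R (swap_rows p) = - OmegaT R p.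
Proof. by apply/matrixP => i j; rewrite !mxE omega_val_swap. Qed.

Lemma OmegaT_skew p : (OmegaT R p)^T = - OmegaT R p.
Proof.
apply/matrixP => i j; rewrite !mxE /omega_val.
by do ?[case: ifP => ?]; rewrite ?opprK ?oppr0 //; exfalso; lia.
Qed.

(** This additive form turns the case analysis on crossings into a comparison of positions, row by
    row, and matches the losers counted along cycles. *)
Lemma omega_valE p a b : irreducible p ->
  omega_val R p a b = (p.2 a < p.2 b)%N%:R - (p.1 a < p.1 b)%N%:R.
Proof.
move=> [[_ _ _ inj1 inj2] _]; rewrite /omega_val.
have [->|ab] := eqVneq a b; first by rewrite !ltnn subr0.
have ab1 : p.1 a <> p.1 b by move/inj1/eqP; rewrite (negPf ab).
have ab2 : p.2 a <> p.2 b by move/inj2/eqP; rewrite (negPf ab).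
case: (ltngtP (p.1 a) (p.1 b)) => // _; case: (ltngtP (p.2 a) (p.2 b)) => // _ /=.
- by rewrite subrr.
- by rewrite sub0r.
- by rewrite subr0.
- by rewrite subr0.
Qed.

(** Entrywise form of the conjugation of [OmegaT] by the arrow of winner [x] and loser [y]: once
    moved next to [x], the letter [y] crosses other letters as [x] and its old self did together. *)
Lemma omega_val_top_move p x y a b : irreducible p -> p.1 x = d.-1 -> p.2 y = d.-1 ->
  (p.2 x < d.-1)%N ->
  omega_val R (top_move p x y) a b = omega_val R p a b + (a == y)%:R * omega_val R p x b
    + (omega_val R p a x + (a == y)%:R * omega_val R p x x) * (b == y)%:R.
Proof.
move=> irr px py xy; rewrite !omega_valE //; last exact: top_move_irreducible.
have [[d2 lt1 lt2 inj1 inj2] _] := irr.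
have x_max z : (p.1 x < p.1 z)%N = false by have := lt1 z; card_lia.
have x_max' z : (p.1 z < p.1 x)%N = (z != x).
  by rewrite ltn_neqAle (inj_eq inj1) leqNgt x_max andbT.
have y_max z : (p.2 y < p.2 z)%N = false by have := lt2 z; card_lia.
have y_max' z : (p.2 z < p.2 y)%N = (z != y).
  by rewrite ltn_neqAle (inj_eq inj2) leqNgt y_max andbT.
rewrite /= !ffunE !ltnn x_max x_max' !subr0 mulr0 addr0.
have xyN : x != y by apply: contraTneq xy => ->; rewrite py ltnn.
have [->|ay] /= := eqVneq a y; have [->|by_] /= := eqVneq b y.
- by rewrite !ltnn y_max y_max' xyN eq_sym xyN /=; ring.
- rewrite y_max mul1r mulr0 addr0 addrAC; congr (_ - _).
  rewrite add0r; congr (_%:R); congr nat_of_bool.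
  by case: ifP => ?; lia.
- rewrite y_max' ay mul0r addr0 mulr1 addrAC; congr (_ - _).
  have -> : (p.2 a < p.2 x)%N%:R = (p.2 a <= p.2 x)%N%:R - (a == x)%:R :> R.
    rewrite (leq_eqVlt (p.2 a)) (inj_eq inj2); have [->|] := eqVneq a x; first by rewrite ltnn subrr.
    by rewrite subr0.
  rewrite ltnS; case: ifP => ax; rewrite ?ltnS.
    by rewrite ltnNge ltnW // leqNgt ax; case: eqVneq => _ /=; ring.
  by rewrite leqNgt ax; case: eqVneq => _ /=; ring.
rewrite !mul0r mulr0 !addr0; congr (_%:R - _); congr nat_of_bool.
by case: ifP => ?; case: ifP => ?; lia.
Qed.

End OmegaTransport.

(** * Loops of the Rauzy diagram as symplectic maps *)

Section Restriction.
Variables (A : finType) (R : realType).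
Local Notation d := #|A|.
Implicit Types (p q : perm_pair A) (x y z : A) (M T : 'M[R]_d).

Lemma conj_tm (X : 'M[R]_d) f w i j :
  (winner_mx f w *m X *m (winner_mx f w)^T) i j = X i j + f (enum_val i) * X (enum_rank w) j
    + (X i (enum_rank w) + f (enum_val i) * X (enum_rank w) (enum_rank w)) * f (enum_val j).
Proof.
have tmX (Y : 'M[R]_d) k l : (winner_mx f w *m Y) k l = Y k l + f (enum_val k) * Y (enum_rank w) l.
  by rewrite mulmxDl mul1mx -mulmxA trmx_delta -rowE mxE [X in _ + X]mxE big_ord1 !mxE.
have mul_tmT (Y : 'M[R]_d) k l :
    (Y *m (winner_mx f w)^T) k l = Y k l + Y k (enum_rank w) * f (enum_val l).
  rewrite raddfD /= trmx1 trmx_mul trmxK mulmxDr mulmx1 mulmxA -colE.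
  by rewrite mxE [X in _ + X]mxE big_ord1 !mxE.
by rewrite mul_tmT !tmX.
Qed.

Lemma tm_unit (f : A -> R) w : f w = 0 -> winner_mx f w \in unitmx.
Proof.
move=> fw; suff : winner_mx f w *m winner_mx (fun z => - f z) w = 1%:M by case/mulmx1_unit.
rewrite mul_tm ?fw ?oppr0 // /winner_mx (_ : letter_col _ = 0) ?mul0mx ?addr0 //.
by apply/matrixP => i j; rewrite !mxE subrr.
Qed.

Lemma OmegaT_step b p p' w l : irreducible p -> rauzy_step b p = Some (p', (w, l)) ->
  theta_arrow R w l \in unitmx /\
  OmegaT R p' = theta_arrow R w l *m OmegaT R p *m (theta_arrow R w l)^T.
Proof.
wlog : b p p' / b = true.
  case: b => [/(_ _ _ _ erefl)|H irr step]; first exact.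
  have [|u E] := H true (swap_rows p) (swap_rows p') erefl (irreducible_swap irr).
    by rewrite -[true]/(~~ false) rauzy_step_swap step.
  split=> //; apply: oppr_inj; move: E.
  by rewrite !OmegaT_swap mulmxN mulNmx.
move=> -> irr step; have [x [y [px py xy [-> -> ->]]]] := rauzy_step_topP irr step.
rewrite theta_arrowE; split.
  by apply: tm_unit; have [xy'|] := eqVneq x y; [rewrite xy' py ltnn in xy|].
apply/matrixP => i j; rewrite conj_tm !mxE !enum_rankK.
exact: omega_val_top_move.
Qed.

Lemma OmegaT_path p q M : irreducible p -> rpath p q M ->
  M \in unitmx /\ OmegaT R q = M *m OmegaT R p *m M^T.
Proof.
move: p q M; apply: rpath_ind => [p _|p b p' w l q M irr step irr' [uM ->]].
  by rewrite unitmx1 trmx1 mulmx1 mul1mx.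
have [ut ->] := OmegaT_step irr step.
by rewrite unitmx_mul uM ut trmx_mul !mulmxA.
Qed.

Lemma Hbasis_free p : row_free (Hbasis R p).
Proof. exact: row_base_free. Qed.

Lemma restr_eq p T N : Hbasis R p *m T^T = N *m Hbasis R p -> restr p T = N.
Proof. by rewrite /restr => ->; rewrite -mulmxA mulmxVp ?mulmx1 // Hbasis_free. Qed.

Lemma Hbasis_inj p m : injective (fun N : 'M_(m, _) => N *m Hbasis R p).
Proof. exact: row_free_inj (Hbasis_free p). Qed.

Lemma Hbasis_sub p q M : M \in unitmx -> OmegaT R q = M *m OmegaT R p *m M^T ->
  exists N, Hbasis R p *m M^T = N *m Hbasis R q.
Proof.
move=> uM OE; apply/submxP; rewrite (eq_row_base (OmegaT R q)).
apply: submx_trans (submxMr _ (_ : _ <= OmegaT R p)%MS) _; first by rewrite eq_row_base.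
by rewrite OE -mulmxA -{1}[_ *m M^T](mulKmx uM) submxMl.
Qed.

Lemma Hbasis_path p q M : irreducible p -> rpath p q M ->
  exists N N', [/\ Hbasis R p *m M^T = N *m Hbasis R q, N *m N' = 1%:M & N' *m N = 1%:M].
Proof.
move=> irr pq; have [uM OE] := OmegaT_path irr pq.
have OE' : OmegaT R p = invmx M *m OmegaT R q *m (invmx M)^T.
  by rewrite OE !mulmxA mulVmx // mul1mx -mulmxA -trmx_mul mulVmx // trmx1 mulmx1.
have uM' : invmx M \in unitmx by rewrite unitmx_inv.
have [N NE] := Hbasis_sub uM OE; have [N' NE'] := Hbasis_sub uM' OE'.
exists N, N'; split=> //; apply: Hbasis_inj.
  by rewrite mul1mx -mulmxA -NE' mulmxA -NE -mulmxA -trmx_mul mulVmx // trmx1 mulmx1.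
by rewrite mul1mx -mulmxA -NE mulmxA -NE' -mulmxA -trmx_mul mulmxV // trmx1 mulmx1.
Qed.

Lemma symplectic_coordinates p : exists (J : 'M[R]_(\rank (OmegaT R p)))
    (h : A -> 'rV_(\rank (OmegaT R p))),
  [/\ J^T = - J, forall a, h a *m Hbasis R p = row (enum_rank a) (OmegaT R p),
      forall a, Hbasis R p *m letter_unit R a = J *m (h a)^T,
      forall a b, sform J (h a) (h b) = omega_val R p a b &
      forall v : 'rV_(\rank (OmegaT R p)), (forall b, sform J v (h b) = 0) -> v = 0].
Proof.
set B := Hbasis R p; have fB := Hbasis_free p.
have [H HE] : exists H, OmegaT R p = H *m B by apply/submxP; rewrite eq_row_base.
have BV : B *m pinvmx B = 1%:M by exact: mulmxVp.
have fullH : row_full H.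
  rewrite -col_leq_rank; apply: leq_trans (mxrankM_maxl H B).
  by rewrite -HE.
have HV : pinvmx H *m H = 1%:M by exact: mulVpmx.
have skew : B^T *m H^T = - (H *m B) by rewrite -trmx_mul -HE OmegaT_skew.
pose J := - (pinvmx H *m B^T).
have JB : J *m H^T = B by rewrite mulNmx -mulmxA skew mulmxN opprK mulmxA HV mul1mx.
have J_skew : J^T = - J.
  have JE : J = B *m (pinvmx H)^T by rewrite -JB -mulmxA -trmx_mul HV trmx1 mulmx1.
  by rewrite {1}JE trmx_mul trmxK /J opprK.
have hT a : (row (enum_rank a) H)^T = H^T *m letter_unit R a by rewrite tr_row colE.
have om_entry v b : sform J v (row (enum_rank b) H) = (v *m B) 0 (enum_rank b).
  by rewrite /sform hT mulmxA -[v *m J *m H^T]mulmxA JB -colE mxE.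
exists J, (fun a => row (enum_rank a) H); split=> //.
- by move=> a; rewrite -row_mul -HE.
- by move=> a; rewrite hT mulmxA JB.
- by move=> a b; rewrite om_entry -row_mul -HE !mxE !enum_rankK.
move=> v v0; apply: Hbasis_inj; rewrite mul0mx; apply/rowP => j.
by rewrite -[j]enum_valK -om_entry v0 mxE.
Qed.

Definition winner_transvec p (s : R) a := winner_mx (fun b => s * omega_val R p a b) a.

Lemma Hbasis_tmO p J (h : A -> 'rV_(\rank (OmegaT R p))) s a :
  h a *m Hbasis R p = row (enum_rank a) (OmegaT R p) -> Hbasis R p *m letter_unit R a = J *m (h a)^T ->
  Hbasis R p *m (winner_transvec p s a)^T = transvec J (h a) s *m Hbasis R p.
Proof.
move=> ha Ba; rewrite /winner_transvec /winner_mx raddfD /= trmx1 trmx_mul trmxK mulmxDr mulmx1 mulmxA Ba.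
rewrite /transvec mulmxDl mul1mx -scalemxAl -[J *m _ *m h a *m _]mulmxA ha scalemxAr.
congr (_ + _ *m _); apply/rowP => j; rewrite !mxE enum_rankK //.
Qed.

(** The losers of a cycle are counted by the form itself: [z] is last at the top and [a] last at the
    bottom, so only one row contributes. Exchanging the rows negates the form, whence the opposite
    signs for [a]. *)
Lemma standard_transvections p a z : irreducible p -> standard p a z ->
  [/\ rpath p p (winner_transvec p 1 z), rpath p p (winner_transvec p (-1) a),
      forall y, y != z -> rpath p p (winner_transvec p 1 z *m winner_transvec p (-1) y) &
      forall y, y != a -> rpath p p (winner_transvec p (-1) a *m winner_transvec p 1 y)].
Proof.
move: p a z; have half p a z : irreducible p -> standard p a z -> rpath p p (winner_transvec p 1 z) /\
    forall y, y != z -> rpath p p (winner_transvec p 1 z *m winner_transvec p (-1) y).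
  move=> irr sp; have [_ _ pz1 pz2] := sp; have [[d2 lt1 _ _ _] _] := irr.
  have tmz : winner_transvec p 1 z = winner_mx (fun b => (p.2 z < p.2 b)%N%:R) z.
    apply: eq_tm => b; rewrite mul1r omega_valE // (_ : (p.1 z < p.1 b)%N = false) ?subr0 //.
    by have := lt1 b; card_lia.
  split=> [|y yz]; rewrite tmz; first exact: standard_cycle sp.
  rewrite (_ : winner_transvec p (-1) y = winner_mx (fun b => (p.1 y < p.1 b)%N%:R - (p.2 y < p.2 b)%N%:R) y).
    exact: standard_inserted_cycle sp yz.
  by apply: eq_tm => b; rewrite mulN1r omega_valE // opprB.
move=> p a z irr sp; have [pz py] := half _ _ _ irr sp.
have tm_swap s b : winner_transvec (swap_rows p) s b = winner_transvec p (- s) b.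
  by apply: eq_tm => c; rewrite omega_val_swap mulrN mulNr.
have [pa pya] := half _ _ _ (irreducible_swap irr) (standard_swap sp).
split=> // [|y ya]; rewrite -[p]swap_rowsK.
  by move/rpath_swap: pa; rewrite tm_swap swap_rowsK.
by move/rpath_swap: (pya y ya); rewrite !tm_swap opprK swap_rowsK.
Qed.

(* Row vectors compose in the order opposite to that of [Theta]. *)
Definition loops p (X : 'M[R]_(\rank (OmegaT R p))) :=
  exists2 T, rpath p p T & Hbasis R p *m T^T = X *m Hbasis R p.

Lemma loops_mul p X Y : loops X -> loops Y -> @loops p (X *m Y).
Proof.
move=> [T pT XT] [T' pT' YT]; exists (T' *m T); first exact: rpath_cat pT pT'.
by rewrite trmx_mul mulmxA XT -[X *m _ *m T'^T]mulmxA YT mulmxA.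
Qed.

(** Loops at a standard permutation are carried to [p] by a path in each direction. These two paths
    need not be inverse to each other, but they act invertibly and are fixed before the weights, so
    the factorisation survives with a larger [K]. *)
Lemma dominated_loops p : irreducible p -> exists r, \rank (OmegaT R p) = r.+1.*2 /\ exists K : R,
  forall (w : 'rV[R]_r) (L : R), exists X l (E F' : 'M[R]_(_, 1 + r)) (F E' : 'M[R]_(1 + r, _)) B,
  [/\ @loops p X, L <= l, X = E *m diag_mx (row_mx l%:M w) *m F + B, E' *m E = 1%:M /\ F *m F' = 1%:M
    & [/\ nrm E <= K, nrm F <= K, nrm E' <= K, nrm F' <= K & nrm B <= K]].
Proof.
move=> irr0; have [p' [a [z [irr [[M pq] [M' qp]] sp]]]] := connected_standard R irr0.
have [N [N' [NE NN' N'N]]] := Hbasis_path irr0 pq.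
have [P [P' [PE PP' P'P]]] := Hbasis_path irr qp.
have rankE : \rank (OmegaT R p) = \rank (OmegaT R p').
  apply/eqP; rewrite eqn_leq -{1}(mxrank1 R (\rank (OmegaT R p))) -NN'.
  rewrite -{3}(mxrank1 R (\rank (OmegaT R p'))) -N'N.
  by rewrite !(leq_trans (mxrankM_maxl _ _)) ?rank_leq_col.
have [J [h [J_skew hB Bev om_h h_span]]] := symplectic_coordinates p'.
have [pz pa pyz pya] := standard_transvections irr sp.
have tvB s b := Hbasis_tmO s (hB b) (Bev b).
have az : a != z.
  by have [pa1 _ pz1 _] := sp; have [[d2 _ _ _ _] _] := irr; apply: contraTneq d2 => azE;
     move: pa1; rewrite azE pz1; card_lia.
have om_p b c := omega_valE R b c irr.
have [pa1 pa2 pz1 pz2] := sp; have [[d2 lt1 lt2 inj1 inj2] _] := irr.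
have om_a b : b != a -> sform J (h a) (h b) = -1.
  move=> ba; rewrite om_h om_p pa1 pa2 (_ : (d.-1 < p'.2 b)%N = false); last first.
    by have := lt2 b; card_lia.
  by rewrite lt0n -pa1 (inj_eq inj1) ba sub0r.
have om_z b : b != z -> sform J (h z) (h b) = 1.
  move=> bz; rewrite om_h om_p pz1 pz2 (_ : (d.-1 < p'.1 b)%N = false); last first.
    by have := lt1 b; card_lia.
  by rewrite lt0n -pz2 (inj_eq inj2) bz subr0.
have loop_z : @loops p' (transvec J (h z) 1) by exists (winner_transvec p' 1 z).
have loop_a : @loops p' (transvec J (h a) (-1)) by exists (winner_transvec p' (-1) a).
have loop_y b : b != a -> b != z -> [/\ sform J (h a) (h b) = -1, sform J (h z) (h b) = 1,
    @loops p' (transvec J (h b) (-1) *m transvec J (h z) 1) &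
    @loops p' (transvec J (h b) 1 *m transvec J (h a) (-1))].
  move=> ba bz; rewrite om_a // om_z //; split=> //.
    by exists (winner_transvec p' 1 z *m winner_transvec p' (-1) b); [exact: pyz|];
    rewrite trmx_mul mulmxA tvB -[_ *m Hbasis R p' *m _]mulmxA tvB mulmxA.
  by exists (winner_transvec p' (-1) a *m winner_transvec p' 1 b); [exact: pya|];
  rewrite trmx_mul mulmxA tvB -[_ *m Hbasis R p' *m _]mulmxA tvB mulmxA.
have za : z != a by rewrite eq_sym.
have [r [nr [K Kw]]] := dominated_core J_skew (@loops_mul p') (om_a _ za) loop_z loop_a loop_y h_span.
exists r; split; first by rewrite rankE.
exists (K + nrm N * K + K * nrm P + K * nrm N' + nrm P' * K + nrm N * K * nrm P) => w L.
have [X [l [E [F' [F [E' [B [[T pT XT] Ll XE [E'E FF'] [nE nF nE' nF' nB]]]]]]]]] := Kw w L.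
have K0 : 0 <= K by apply: le_trans (nrm_ge0 E) nE.
exists (N *m X *m P), l, (N *m E), (P' *m F'), (F *m P), (E' *m N'), (N *m B *m P).
have pos := (nrm_ge0 N, nrm_ge0 N', nrm_ge0 P, nrm_ge0 P').
have c1 : 0 <= nrm N * K by rewrite mulr_ge0 ?pos.
have c2 : 0 <= K * nrm P by rewrite mulr_ge0 ?pos.
have c3 : 0 <= K * nrm N' by rewrite mulr_ge0 ?pos.
have c4 : 0 <= nrm P' * K by rewrite mulr_ge0 ?pos.
have c5 : 0 <= nrm N * K * nrm P by rewrite mulr_ge0 ?pos.
split=> //.
- exists (M' *m T *m M); first by rewrite -mulmxA; apply: rpath_cat (rpath_cat pq pT) qp.
  rewrite 2!trmx_mul (mulmxA (Hbasis R p)) NE -(mulmxA N) (mulmxA (Hbasis R p')) XT.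
  by rewrite -(mulmxA X) PE !mulmxA.
- by rewrite XE mulmxDr mulmxDl !mulmxA.
- split; first by rewrite mulmxA -[E' *m N' *m N]mulmxA N'N mulmx1.
  by rewrite mulmxA -[F *m P *m P']mulmxA PP' mulmx1.
split.
- by apply: le_trans (nrmM_le (lexx _) nE) _; lra.
- by apply: le_trans (nrmM_le nF (lexx _)) _; lra.
- by apply: le_trans (nrmM_le nE' (lexx _)) _; lra.
- by apply: le_trans (nrmM_le (lexx _) nF') _; lra.
by apply: le_trans (nrmM_le (nrmM_le (lexx _) nB) (lexx _)) _; lra.
Qed.

End Restriction.

Theorem theorem6p1 (R : realType) (A : finType) (p : perm_pair A) :
  irreducible p ->
  let g := (\rank (OmegaT R p))./2 in
  forall C : R, 0 < C ->
  exists (gamma : seq bool) (T : 'M[R]_#|A|) (s : nat -> R),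
    [/\ in_rauzy_monoid p gamma T,
        singular_values (restr p T) s,
        C < ln (s g.-1) &
        forall i : nat, (1 <= i)%N -> (i <= g.-1)%N ->
          C * ln (s i) < ln (s i.-1)].
Proof.
move=> irr g C C0; have [r [nr [K Kw]]] := dominated_loops R irr.
have gr : g.-1 = r by rewrite /g nr doubleK.
(* The term [n * n] bounds the entrywise norm of orthogonal matrices, whose entries are at most 1 in
   absolute value. *)
pose n := \rank (OmegaT R p); pose K' := `|K| + (n * n)%:R + 1.
have KK' : K <= K' by rewrite /K' -addrA; apply: le_trans (ler_norm _) _; rewrite lerDl addr_ge0.
have K'0 : 0 < K' by rewrite ltr_wpDl // addr_ge0.
have nK' : (n * n)%:R <= K' by rewrite /K' -addrA addrCA lerDl addr_ge0.
have [w [L wL]] := pinching_weights K'0 C0 r.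
have [X [l [E [F' [F [E' [B [[T pT XT] Ll XE [E'E FF'] [nE nF nE' nF' nB]]]]]]]]] := Kw w L.
have [D_mono D_gt0 sP] := wL l Ll.
(* Invertibility comes from [Theta] being an isomorphism along paths; it makes all singular values
   positive, as their logarithms require. *)
have uX : X \in unitmx.
  have [N [N' [NE NN' _]]] := Hbasis_path irr pT.
  by have -> : X = N; [apply: Hbasis_inj; rewrite -NE XT|case/mulmx1_unit: NN'].
have [s [U [V [s_mono s_gt0 oU oV XS]]]] := singular_values_unitmx uX.
have [gamma pgamma] := pT.
have in_range (i : 'I_(1 + r)) : (i < n)%N by rewrite (leq_trans (ltn_ord i)) // /n nr add1n -addnn leq_addr.
have [|sr si] := sP s.
  move=> i; split; first exact: s_gt0 (in_range i).
    apply: (singular_value_le s_mono s_gt0 oU oV XS XE) => //; by [exact: le_trans KK'|].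
  by apply: (singular_value_ge s_mono s_gt0 oU oV XS XE E'E FF') => //; exact: le_trans KK'.
exists gamma, T, s; split=> //; last 1 first.
- by move=> i i1; rewrite gr; apply: si.
- rewrite (restr_eq XT); split=> //; first by move=> i ltin; apply: ltW; apply: s_gt0.
  by exists U, V.
by rewrite gr.
Qed.
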